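(* Let $0\le k\le n$, let $\lambda\vdash k$ be a partition, and let $s\ge \ell(\lambda)$. Then the set of monomials $\mathcal{B}_{n,\lambda,s}:=\{\mathbf{x}^{\mathbf{b}} : \mathbf{b}\in\mathcal{D}_{n,\lambda,s}\}$ descends to a ($\mathbb{Q}$-vector space) basis of $R_{n,\lambda,s}$.
   Context: For $\mathbf{b}=(b_1,\dots,b_n)\in\mathbb{Z}_{\ge0}^n$ write $\mathbf{x}^{\mathbf{b}}=x_1^{b_1}\cdots x_n^{b_n}$. The ring $R_{n,\lambda,s}$: let $\lambda'=(\lambda'_1\ge\dots\ge\lambda'_n\ge0)$ be the transpose of $\lambda$, padded with zeros to length $n$. For a subset $S$ of the variables $\{x_1,\dots,x_n\}$ let $e_d(S)$ be the sum of all squarefree monomials of degree $d$ in the variables of $S$. Let $I_{n,\lambda,s}\subset\mathbb{Q}[x_1,\dots,x_n]$ be the ideal generated by $x_i^s$ ($1\le i\le n$) and all $e_d(S)$ with $S\subseteq\{x_1,\dots,x_n\}$ and $d>|S|-(\lambda'_n+\lambda'_{n-1}+\dots+\lambda'_{n-|S|+1})$. Set $R_{n,\lambda,s}=\mathbb{Q}[x_1,\dots,x_n]/I_{n,\lambda,s}$. Descent words: for $\sigma\in\mathfrak{S}_m$ in one-line notation let $g_\sigma(\mathbf{x})=\prod_{i:\,\sigma_i>\sigma_{i+1}}x_{\sigma_1}x_{\sigma_2}\cdots x_{\sigma_i}$, and let $\mathcal{D}_m=\{\mathbf{a}\in\mathbb{Z}_{\ge0}^m:\mathbf{x}^{\mathbf{a}}=g_\sigma(\mathbf{x})\text{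 for some }\sigma\in\mathfrak{S}_m\}$. For a word $\mathbf{a}=(a_1,\dots,a_n)$ and $A=\{i_1<\dots<i_r\}\subseteq[n]$ put $\mathbf{a}|_A=(a_{i_1},\dots,a_{i_r})$. Let $\mathcal{OSP}_{n,\lambda'}$ be the collection of ordered set partitions $(A_1|\cdots|A_{\lambda_1}|B_1|\cdots|B_{n-k})$ of $[n]$ with $|A_i|=\lambda'_i$ and $|B_j|=1$ for all $i,j$. Then $\mathcal{D}_{n,\lambda,s}$ is the set of $\mathbf{a}\in\mathbb{Z}_{\ge0}^n$ for which there is some $(A_1|\cdots|A_{\lambda_1}|B_1|\cdots|B_{n-k})\in\mathcal{OSP}_{n,\lambda'}$ with $\mathbf{a}|_{A_i}\in\mathcal{D}_{\lambda'_i}$ for all $i$ and $\mathbf{a}|_{B_j}\in\{0,1,\dots,s-1\}$ for all $j$. *)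

(* Defs.v *)
(* boolp is used only to get a boolean membership test for a generated ideal, as
   the library's quotients require. *)
From HB Require Import structures.
From mathcomp Require Import all_boot all_order all_fingroup all_algebra.
From mathcomp Require Import generic_quotient ring_quotient.
From mathcomp Require Import boolp.
From mathcomp Require Import mpoly.

Set Implicit Arguments.
Unset Strict Implicit.
Unset Printing Implicit Defensive.

Import GRing.Theory.
Local Open Scope ring_scope.
Local Open Scope quotient_scope.

(* The ring structure the library puts on {ideal_quot _} requires a proper ideal.
   The zero ring must be allowed here (x_i ^ 0 = 1 is a generator when s = 0), so
   the Z-module quotient is made into a possibly zero commutative ring, and into a
   K-module. *)
Section IdealQuotient.
Variables (K : comNzRingType) (A : comAlgType K) (G : A -> Prop).

Definition ideal_gen (p : A) : bool :=
  `[< exists2 c : seq (A * A),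
        (forall ag, ag \in c -> G ag.2) & p = \sum_(ag <- c) ag.1 * ag.2 >].

Lemma ideal_gen_zmod_closed : zmod_closed ideal_gen.
Proof.
split=> [|x y /asboolP[c cG ->] /asboolP[d dG ->]]; apply/asboolP.
  by exists [::]; rewrite ?big_nil.
exists (c ++ [seq (- ag.1, ag.2) | ag <- d]).
  move=> ag; rewrite mem_cat => /orP[/cG //|/mapP[bg bgd ->] /=].
  exact: dG.
rewrite big_cat big_map /=; congr (_ + _).
by rewrite -sumrN; apply: eq_bigr => ag _; rewrite mulNr.
Qed.

HB.instance Definition _ := GRing.isZmodClosed.Build A ideal_gen
  ideal_gen_zmod_closed.

Lemma ideal_genM (a u : A) : u \in ideal_gen -> a * u \in ideal_gen.
Proof.
move=> /asboolP[c cG ->]; apply/asboolP.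
exists [seq (a * ag.1, ag.2) | ag <- c] => [ag /mapP[bg bgc ->] /=|].
  exact: cG.
by rewrite big_map mulr_sumr; apply: eq_bigr => ag _; rewrite mulrA.
Qed.

Definition ideal : zmodClosed A := GRing.ZmodClosed.clone A ideal_gen _.

Definition ideal_quotient : Type := {ideal_quot ideal}.

HB.instance Definition _ := Quotient.on ideal_quotient.
HB.instance Definition _ := GRing.Zmodule.on ideal_quotient.

Local Notation Q := ideal_quotient.

Lemma ideal_quotient_ind (P : Q -> Prop) :
  (forall a : A, P (\pi_Q a)) -> forall x : Q, P x.
Proof. by move=> Ppi x; rewrite -[x]reprK. Qed.

Lemma ideal_quotient_eqE (x y : A) :
  (\pi_Q x == \pi_Q y) = (x - y \in ideal_gen).
Proof. by rewrite Quotient.idealrBE. Qed.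

Lemma ideal_quotient_piD (x y : A) : \pi_Q (x + y) = \pi_Q x + \pi_Q y.
Proof. exact: (raddfD (\pi_{ideal_quot ideal})). Qed.

Definition ideal_quotient_one : Q := \pi_Q 1.
Definition ideal_quotient_mul (x y : Q) : Q := \pi_Q (repr x * repr y).
Definition ideal_quotient_scale (a : K) (x : Q) : Q := \pi_Q (a *: repr x).

Lemma ideal_quotient_piM (x y : A) :
  ideal_quotient_mul (\pi_Q x) (\pi_Q y) = \pi_Q (x * y).
Proof.
apply/eqP; rewrite ideal_quotient_eqE.
set x' := repr _; set y' := repr _.
have xP : x' - x \in ideal_gen by rewrite -ideal_quotient_eqE reprK.
have yP : y' - y \in ideal_gen by rewrite -ideal_quotient_eqE reprK.
have -> : x' * y' - x * y = y' * (x' - x) + x * (y' - y).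
  by rewrite !mulrBr addrA (mulrC y' x') (mulrC y' x) subrK.
by rewrite rpredD ?ideal_genM.
Qed.

Lemma ideal_quotient_piZ (a : K) (x : A) :
  ideal_quotient_scale a (\pi_Q x) = \pi_Q (a *: x).
Proof.
apply/eqP; rewrite ideal_quotient_eqE -scalerBr -mulr_algl ideal_genM //.
by rewrite -ideal_quotient_eqE reprK.
Qed.

Lemma ideal_quotient_mulA : associative ideal_quotient_mul.
Proof.
elim/ideal_quotient_ind=> x; elim/ideal_quotient_ind=> y.
elim/ideal_quotient_ind=> z.
by rewrite !ideal_quotient_piM mulrA.
Qed.

Lemma ideal_quotient_mulC : commutative ideal_quotient_mul.
Proof.
elim/ideal_quotient_ind=> x; elim/ideal_quotient_ind=> y.
by rewrite !ideal_quotient_piM mulrC.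
Qed.

Lemma ideal_quotient_mul1 : left_id ideal_quotient_one ideal_quotient_mul.
Proof. by elim/ideal_quotient_ind=> x; rewrite ideal_quotient_piM mul1r. Qed.

Lemma ideal_quotient_mulDl : left_distributive ideal_quotient_mul +%R.
Proof.
elim/ideal_quotient_ind=> x; elim/ideal_quotient_ind=> y.
elim/ideal_quotient_ind=> z.
by rewrite -ideal_quotient_piD !ideal_quotient_piM mulrDl ideal_quotient_piD.
Qed.

HB.instance Definition _ := GRing.Zmodule_isComPzRing.Build ideal_quotient
  ideal_quotient_mulA ideal_quotient_mulC ideal_quotient_mul1
  ideal_quotient_mulDl.

Lemma ideal_quotient_scaleA a b x :
  ideal_quotient_scale a (ideal_quotient_scale b x)
    = ideal_quotient_scale (a * b) x.
Proof. by elim/ideal_quotient_ind: x => x; rewrite !ideal_quotient_piZ scalerA. Qed.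

Lemma ideal_quotient_scale1 : left_id 1 ideal_quotient_scale.
Proof. by elim/ideal_quotient_ind=> x; rewrite ideal_quotient_piZ scale1r. Qed.

Lemma ideal_quotient_scaleDr : right_distributive ideal_quotient_scale +%R.
Proof.
move=> a; elim/ideal_quotient_ind=> x; elim/ideal_quotient_ind=> y.
by rewrite -ideal_quotient_piD !ideal_quotient_piZ scalerDr ideal_quotient_piD.
Qed.

Lemma ideal_quotient_scaleDl x :
  {morph ideal_quotient_scale^~ x : a b / a + b}.
Proof.
elim/ideal_quotient_ind: x => x a b.
by rewrite !ideal_quotient_piZ scalerDl ideal_quotient_piD.
Qed.

HB.instance Definition _ := GRing.Zmodule_isLmodule.Build K ideal_quotient
  ideal_quotient_scaleA ideal_quotient_scale1 ideal_quotient_scaleDr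
  ideal_quotient_scaleDl.

End IdealQuotient.

(* The family (v i) indexed by the i satisfying J is a basis; in particular v is
   then injective on J when K is nontrivial. *)
Definition is_basis (K : nzRingType) (V : lmodType K) (I : choiceType)
    (J : I -> Prop) (v : I -> V) : Prop :=
  (forall (r : seq I) (c : I -> K),
      uniq r -> (forall i, i \in r -> J i) ->
      \sum_(i <- r) c i *: v i = 0 -> forall i, i \in r -> c i = 0)
  /\
  (forall x : V, exists (r : seq I) (c : I -> K),
      (forall i, i \in r -> J i) /\ x = \sum_(i <- r) c i *: v i).

Section Partitions.
Local Open Scope nat_scope.

Definition is_part (k : nat) (la : seq nat) : bool :=
  [&& sorted geq la, 0 \notin la & sumn la == k].

(* conj_part la j is the j-th part, counted from j = 1, of the transpose; it is
   0 for j > head 0 la, which is the padding by zeros. *)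
Definition conj_part (la : seq nat) (j : nat) : nat := count (leq j) la.

End Partitions.

Definition esym_on (n : nat) (S : {set 'I_n}) (d : nat) : {mpoly rat[n]} :=
  \sum_(T : {set 'I_n} | (T \subset S) && (#|T| == d)) \prod_(i in T) 'X_i.

(* The bound d > |S| - (la'_n + ... + la'_{n-|S|+1}) is written additively to
   avoid truncated subtraction. *)
Definition I_gen (n : nat) (la : seq nat) (s : nat) (p : {mpoly rat[n]}) : Prop :=
  (exists i : 'I_n, p = 'X_i ^+ s) \/
  (exists (S : {set 'I_n}) (d : nat),
     (#|S| < d + \sum_((n - #|S|).+1 <= j < n.+1) conj_part la j)%N
     /\ p = esym_on S d).

Definition Rnls (n : nat) (la : seq nat) (s : nat) : lmodType rat :=
  ideal_quotient (@I_gen n la s).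

(* A descent i is encoded as the pair (i, i + 1) of indices, since i + 1 need not
   be an index for i : 'I_m. *)
Definition descent_monomial (m : nat) (sigma : 'S_m) : {mpoly rat[m]} :=
  \prod_(ii : 'I_m * 'I_m |
           (ii.2 == ii.1.+1 :> nat) && (sigma ii.2 < sigma ii.1)%N)
    \prod_(l : 'I_m | (l <= ii.1)%N) 'X_(sigma l).

Definition descent_word (m : nat) (a : 'X_{1..m}) : Prop :=
  exists sigma : 'S_m, 'X_[a] = descent_monomial sigma.

(* enum_val lists the elements of a set of ordinals in increasing order. *)
Definition restrict (n : nat) (a : 'X_{1..n}) (A : {set 'I_n}) : 'X_{1..#|A|} :=
  [multinom a (enum_val i) | i < #|A|].

Definition ordered_set_partition (n : nat) (P : seq {set 'I_n}) : bool :=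
  uniq P && partition [set X in P] [set: 'I_n].

Definition in_OSP (n k : nat) (la : seq nat)
    (A : {ffun 'I_(head 0%N la) -> {set 'I_n}})
    (B : {ffun 'I_(n - k) -> {set 'I_n}}) : bool :=
  [&& ordered_set_partition (codom A ++ codom B),
      [forall i, #|A i| == conj_part la i.+1] & [forall j, #|B j| == 1%N]].

Definition Dnls (n k : nat) (la : seq nat) (s : nat) (a : 'X_{1..n}) : Prop :=
  exists (A : {ffun 'I_(head 0%N la) -> {set 'I_n}})
         (B : {ffun 'I_(n - k) -> {set 'I_n}}),
    [/\ in_OSP A B,
        forall i, descent_word (restrict a (A i)) &
        forall j (l : 'I_#|B j|), (restrict a (B j) l < s)%N].

Definition Bnls (n k : nat) (la : seq nat) (s : nat) (p : {mpoly rat[n]}) : Prop :=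
  exists2 b : 'X_{1..n}, Dnls k la s b & p = 'X_[b].

(* Main.v *)
Require Import Defs.
From HB Require Import structures.
From mathcomp Require Import all_boot all_order all_fingroup all_algebra.
From mathcomp Require Import generic_quotient ring_quotient.
From mathcomp Require boolp.
From mathcomp Require Import zify ring.
From mathcomp Require Import mpoly.

(** Let X be the set of words of length n over the letters 0, ..., s - 1 in
    which every letter r occurs at least la_r times, where la_r = 0 past the
    end of la. The monomials of D_{n,la,s} are independent modulo the ideal,
    there are at least #|X| of them, and #|X| polynomials span the quotient.
    So #|X| of the monomials already form a basis ([independent_spans]), and
    all of D_{n,la,s} is a spanning set that is still independent.

    At least #|X| monomials. Order the pairs (position p, letter v) by the time
    n * v + (n - 1 - p), so that lowering a letter by one subtracts n from its
    time. A set of positions carries a descent word as soon as it is linked: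
    each of its times is below n or exceeds another of its times by less than n
    ([linked_descent_word]). A word c of X is turned into a word with the
    required disjoint linked sets by sweeping, for each letter r in turn,
    through the times from high to low, and lowering the letter met at time
    y + n whenever fewer than la_r times lie strictly between y and y + n.
    At stage r each of the first la_r sets receives one new position of letter
    r, and the sweep lowers letters exactly when this is needed to link the new
    position to the rest of its set ([step_chains]). The count of the times in
    a window shows whether a letter has been lowered, so a step can be undone
    ([step_inj]), and distinct words of X give distinct words ([sweeps_inj]).

    Independence. Let b be in D_{n,la,s}. In a block A_i the descent word is
    completed by exponents c to a bijection delta = b + c from A_i to
    {0, ..., |A_i| - 1}; on singletons delta = b. The functional sending x^e to
    the determinant T(e + c) of the matrix with entries
    [p, q in the same block and e_p + c_p = delta_q] kills the ideal. It is
    antisymmetric inside blocks, which settles e_d(S) if two exponents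
    agree on a block contained in S; otherwise the exponents already fill such
    a block, and e_d(S) has too large a degree to avoid all of them
    ([block_det_esym]). The functional takes the value 1 at x^b. If it does not
    vanish at another x^e then e + c is delta permuted inside the blocks, and
    the rearrangement inequality makes the convex score sum_p (n e_p - p)^2
    larger at e than at b ([score_lt]). So in a relation the monomial of
    largest score has coefficient 0 ([triangular_independence]).

    Spanning. For a set V of variables and multiplicities m there is an ideal
    I(V, m) defined as the ideal of the theorem, with the variables outside V
    added. If p is in V and r is the letter of rank i for decreasing m, then
    X_p^i I(V - p, m - 1_r) is contained in I(V, m) + (X_p^(i+1))
    ([tanisaki_step]). Hence spanning polynomials for V - p and m - 1_r,
    multiplied by X_p^i, for all letters r, span for V and m
    ([spanning_list_spans]); their number satisfies the recursion that counts
    X by the first letter. *)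

Set Implicit Arguments.
Unset Strict Implicit.
Unset Printing Implicit Defensive.
Local Open Scope nat_scope.

(** * Linked sets and chains *)

Section Linked.
Variable n : nat.
Implicit Types (a b : {ffun 'I_n -> nat}) (p q e f g : 'I_n) (A R : {set 'I_n}).

(** The key of the sort by decreasing letter, then increasing position, read
    backwards: a predecessor within time n is a letter one below at a smaller
    position, or the same letter at a larger position. *)
Definition time a p := n * a p + rev_ord p.

Lemma time_divn a p : time a p %/ n = a p.
Proof.
have n0 : 0 < n by case: p => m; lia.
by rewrite /time mulnC divnMDl // divn_small ?addn0 // ltn_ord.
Qed.

Lemma time_inj a : injective (time a).
Proof.
move=> p q pq; apply: (can_inj (@rev_ordK n)); apply: val_inj => /=.
have: time a p %% n = time a q %% n by rewrite pq.
by rewrite /time ![n * _]mulnC !modnMDl !modn_small ?(ltn_ord (rev_ord _)).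
Qed.

Definition linked a A := forall p, p \in A ->
  time a p < n \/ exists2 q, q \in A & time a q < time a p < time a q + n.

(** If g is not itself a predecessor of p, the earliest element of A that is not
    before p supplies one. *)
Lemma linked_insert a A g p : linked a A -> g \in A ->
  time a p < time a g + n ->
  time a p < n \/ exists2 q, q \in A & time a q < time a p < time a q + n.
Proof.
move=> lA gA pg; case: (ltnP (time a g) (time a p)) => [gp|pleg].
  by right; exists g; rewrite // gp pg.
have gP : (g \in A) && (time a p <= time a g) by rewrite gA.
case: (@arg_minnP _ g [pred x | (x \in A) && (time a p <= time a x)]
        (time a) gP) => x /andP[xA px] xmin.
have [xn|[q qA /andP[qx xq]]] := lA x xA; first by left; lia.
right; exists q => //; apply/andP; split; last by lia.
rewrite ltnNge; apply/negP => pq.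
by have := xmin q; rewrite inE qA pq => /(_ isT); lia.
Qed.

Lemma linkedU a A R g : linked a A -> g \in A ->
  (forall p, p \in R -> time a p < time a g + n) -> linked a (A :|: R).
Proof.
move=> lA gA Rg p; rewrite inE => /orP[pA|/Rg pg].
  have [|[q qA qp]] := lA p pA; first by left.
  by right; exists q; rewrite // inE qA.
have [|[q qA qp]] := linked_insert lA gA pg; first by left.
by right; exists q; rewrite // inE qA.
Qed.

(** Removing the latest element of a linked set breaks no link. *)
Lemma linked_trunc a A k : linked a A -> k <= #|A| ->
  exists A', [/\ A' \subset A, #|A'| = k & linked a A'].
Proof.
move=> + kA; have [m mE] : exists m, #|A| = k + m by exists (#|A| - k); lia.
elim: m A {kA} mE => [|m IH] A mE lA.
  by exists A; split=> //; rewrite mE addn0.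
have /card_gt0P[g gA] : 0 < #|A| by lia.
case: (@arg_maxnP _ g (mem A) (time a) gA) => x xA xmax.
have cA : #|A :\ x| = k + m by have := cardsD1 x A; rewrite (xA : x \in A); lia.
have lAx : linked a (A :\ x).
  move=> p; rewrite !inE => /andP[px pA].
  have [|[q qA qp]] := lA p pA; first by left.
  right; exists q => //; rewrite !inE qA andbT; apply/eqP => qx.
  by have := xmax p pA; move: qp; rewrite qx /=; lia.
have [A' [A'A cA' lA']] := IH _ cA lAx.
by exists A'; split=> //; apply: subset_trans A'A (subsetDl _ _).
Qed.

Lemma eq_linked a b A : {in A, forall p, a p = b p} -> linked a A -> linked b A.
Proof.
move=> ab lA p pA.
have tE q : q \in A -> time b q = time a q by move=> qA; rewrite /time ab.
have [|[q qA qp]] := lA p pA; first by left; rewrite tE.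
by right; exists q; rewrite // !tE.
Qed.

Definition window a y := [set q | y < time a q < y + n].

(** The letter at time y + n is lowered, and thus moves to time y, when fewer
    than k times lie strictly between. *)
Definition step k y a := [ffun p =>
  if (time a p == y + n) && (#|window a y| < k) then (a p).-1 else a p].

Lemma time_step k y a p : time (step k y a) p =
  if (time a p == y + n) && (#|window a y| < k) then y else time a p.
Proof.
rewrite {1}/time ffunE; case: ifP => // /andP[/eqP pE _].
have a0 : 0 < a p.
  by move: pE; rewrite /time; case: (a p) => //; have := ltn_ord (rev_ord p); lia.
by move: pE; rewrite /time -{1}(prednK a0); lia.
Qed.

(** The invariant of a sweep that has come down to time x. The sets with
    i < k have just received a new position: such a set owns a witness of time
    in [x, x + n), and it is linked either with or without this witness. At
    x = 0 a witness has time below n, so that the sets are linked. *)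
Definition chains L (h : 'I_L -> nat) k x M a := exists A : 'I_L -> {set 'I_n},
  [/\ forall i j p, p \in A i -> p \in A j -> i = j,
      forall i, #|A i| = h i,
      forall i p, p \in A i -> time a p < M,
      forall i : 'I_L, k <= i -> linked a (A i) &
      forall i : 'I_L, i < k -> exists e, [/\ e \in A i, x <= time a e < x + n &
        linked a (A i) \/ linked a (A i :\ e)]].

Lemma chains_witness L (h : 'I_L -> nat) k x M a : k <= L ->
  chains h k x M a -> k <= #|[set q | x <= time a q < x + n]|.
Proof.
move=> kL [A [disA _ _ _ Ak]].
have /fin_all_exists[e eP] : forall i : 'I_k, exists e,
  e \in A (widen_ord kL i) /\ x <= time a e < x + n.
  by move=> i; have [e [? ? _]] := Ak (widen_ord kL i) (ltn_ord i); exists e.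
have ei : injective e.
  move=> i j ij; have := disA _ _ _ (eP i).1; rewrite ij => /(_ _ (eP j).1).
  by move/(congr1 val) => /= ?; apply: val_inj.
rewrite -[X in X <= _]card_ord -(card_imset _ ei); apply: subset_leq_card.
by apply/subsetP => _ /imsetP[i _ ->]; rewrite inE (eP i).2.
Qed.

(** If p is lowered in a but has the same final letter in b without being
    lowered, then its time in b is y, and the times of b in (y, y + n] are those
    of the window of a, fewer than k. So the number of witnesses rules this out. *)
Lemma step_inj k y a b :
  k <= #|[set q | y.+1 <= time a q < y.+1 + n]| ->
  k <= #|[set q | y.+1 <= time b q < y.+1 + n]| ->
  step k y a = step k y b -> a = b.
Proof.
wlog suff: a b / k <= #|[set q | y.+1 <= time a q < y.+1 + n]| ->
  step k y a = step k y b -> forall p, (time a p == y + n) && (#|window a y| < k) ->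
  ~~ ((time b p == y + n) && (#|window b y| < k)) ->
  k <= #|[set q | y.+1 <= time b q < y.+1 + n]| -> False.
  move=> H ka kb ab; apply/ffunP => p.
  have := congr1 (fun c : {ffun _} => c p) ab; rewrite !ffunE.
  case: ifP => [pa|/negbT npa]; case: ifP => [pb|/negbT npb] //.
  - move=> _; rewrite -(time_divn a p) -(time_divn b p).
    by case/andP: pa => /eqP-> _; case/andP: pb => /eqP-> _.
  - by case: (H a b ka ab p pa npb kb).
  - by case: (H b a kb (esym ab) p pb npa ka).
move=> ka ab p /andP[/eqP pa wa] npb kb.
have tab q : time (step k y a) q = time (step k y b) q by rewrite ab.
have pb : time b p = y.
  by have := tab p; rewrite !time_step pa eqxx wa /= (negbTE npb).
have other q : q != p -> time a q != y + n.
  by apply: contraNneq => qa; apply/eqP/(@time_inj a); rewrite qa pa.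
have wab : window a y = [set q | y.+1 <= time b q < y.+1 + n].
  apply/setP => q; rewrite !inE; case: (altP (q =P p)) => [->|qp].
    by rewrite pa pb; lia.
  have := tab q; rewrite !time_step (negbTE (other q qp)) /=.
  have qy : time b q != y by apply: contraNneq qp => qb; apply/eqP/(@time_inj b);
    rewrite qb pb.
  have qn : time b q != y + n.
    apply: contraNneq qp => qn; have := congr1 (modn^~ n) qn.
    rewrite /= modnDr -pb /time ![n * _]mulnC !modnMDl.
    by rewrite !modn_small ?(ltn_ord (rev_ord _)) // => /val_inj/rev_ord_inj->.
  by rewrite (negbTE qn) /= => ->; lia.
by move: wa; rewrite wab; lia.
Qed.
End Linked.

Section StepChains.
Variable n : nat.
Implicit Types (a b : {ffun 'I_n -> nat}) (p q e f g : 'I_n) (A R : {set 'I_n}).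

(** A new latest element joins a linked set through any earlier element g
    within time n. *)
Lemma linked_add a A e g : linked a (A :\ e) -> e \in A -> g \in A -> g != e ->
  time a e < time a g + n -> linked a A.
Proof.
move=> lA eA gA ge eg; rewrite -(setD1K eA) setUC.
by apply: (@linkedU n a _ _ g lA); [rewrite !inE ge gA|move=> p /set1P->].
Qed.

Lemma windowW a y p : p \in window a y -> y <= time a p < y + n.
Proof. by rewrite inE => /andP[/ltnW-> ->]. Qed.

Lemma window_close a y p q : p \in window a y -> q \in window a y ->
  time a p < time a q + n.
Proof. by rewrite !inE; lia. Qed.

Lemma window_next a y e q : time a e = y + n -> q \in window a y ->
  time a q < time a e < time a q + n.
Proof. by rewrite inE => ->; lia. Qed.

Lemma window_neq a y e q : time a e = y + n -> q \in window a y -> q != e.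
Proof. by move=> te; apply: contraTneq => ->; rewrite inE te; lia. Qed.

(** The heart of the construction. Let e0 have time y + n. If e0 is not a
    witness then all k witnesses lie in the window and nothing changes. Let e0
    be the witness of A j0. If e0 is lowered, the window consists of the other
    witnesses, so no element of A j0 lies in it and A j0 is linked without e0.
    If e0 stays, either an element of A j0 in the window takes over as witness,
    or the window has an element g that is not a witness. In the latter case
    A j0 acquires a witness by exchanging elements with the set that owns g, or
    by dropping e0 for g when no set owns g. *)
Lemma step_chains L (h : 'I_L -> nat) k s M y a :
  k <= L -> (forall i : 'I_L, i < k -> h i = s) ->
  (forall i : 'I_L, k <= i -> h i < s) -> y + n < M ->
  chains h k y.+1 M a -> chains h k y M (step k y a).
Proof.
move=> kL hk hnk yM cA.
case: cA => A [disA cardA timeA lA witA].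
(* If no letter has time y + n, all witnesses survive. *)
have [e0 te0|no_e0] := pickP (fun p => time a p == y + n); last first.
  have -> : step k y a = a by apply/ffunP=> p; rewrite ffunE no_e0.
  exists A; split=> // i /witA[e [eA te le]]; exists e; split=> //.
  by have := no_e0 e; move: te; clear; lia.
move/eqP: te0 => te0; have n0 : 0 < n := leq_ltn_trans (leq0n _) (ltn_ord e0).
have /fin_all_exists[e eP] : forall i : 'I_L, exists e, i < k ->
    [/\ e \in A i, y.+1 <= time a e < y.+1 + n
      & linked a (A i) \/ linked a (A i :\ e)].
  by move=> i; case: (ltnP i k) => [/witA[e eP]|_]; [exists e|exists e0].
have early p : p != e0 -> time a p != y + n.
  by apply: contraNneq => pE; apply/eqP/(@time_inj n a); rewrite pE te0.
have inw p : y.+1 <= time a p < y.+1 + n -> p != e0 -> p \in window a y.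
  by move=> tp /early tp'; rewrite inE; move: tp tp'; clear; lia.
have einj (i j : 'I_L) : i < k -> j < k -> e i = e j -> i = j.
  move=> ik jk eij; case: (eP i ik) => eAi _ _; case: (eP j jk) => eAj _ _.
  by apply: (disA _ _ (e i)) => //; rewrite eij.
have not_window j : (j : 'I_L) < k -> e j != e0 -> e j \in window a y.
  by move=> jk; apply: inw; case: (eP j jk).
(* If e0 is not a witness, the k witnesses all lie in the window and e0 stays. *)
have [j0 /andP[j0k /eqP ej0]|no_j0] := pickP (fun j : 'I_L => (j < k) && (e j == e0));
  last first.
  have kw : k <= #|window a y|.
    have ei : injective (fun i : 'I_k => e (widen_ord kL i)).
      move=> i j eij; apply: val_inj.
      by have /(congr1 val) := @einj (widen_ord kL i) (widen_ord kL j) (ltn_ord i) (ltn_ord j)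
        eij.
    rewrite -[X in X <= _]card_ord -(card_imset _ ei); apply: subset_leq_card.
    apply/subsetP => _ /imsetP[i _ ->]; apply: not_window => //=.
    by have := no_j0 (widen_ord kL i); rewrite /= ltn_ord /= => ->.
  have -> : step k y a = a.
    by apply/ffunP=> p; rewrite ffunE [X in _ && X]ltnNge kw andbF.
  exists A; split=> // i ik; exists (e i); case: (eP i ik) => eA te le; split=> //.
  by have := no_j0 i; rewrite ik /= => /negbT/early; move: te; clear; lia.
have [e0A _ le0] := eP j0 j0k; rewrite ej0 in e0A le0.
have others (i : 'I_L) : i < k -> i != j0 -> e i \in window a y.
  move=> ik ij; apply: not_window => //; apply: contraNneq ij => eie.
  by apply/eqP/einj; rewrite ?ej0.
have linked_window q : q \in A j0 -> q \in window a y -> linked a (A j0).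
  rewrite inE => qA qw; case: le0 => // le0.
  have qw' : q \in window a y by rewrite inE.
  apply: (@linked_add a _ e0 q); rewrite ?(window_neq te0) //.
  by case/andP: (window_next te0 qw').
pose others_wit := [set e i | i in [set i : 'I_L | (i < k) && (i != j0)]].
have wit_window : others_wit \subset window a y.
  by apply/subsetP=> _ /imsetP[i + ->]; rewrite inE => /andP[ik ij]; apply: others.
have card_wit : #|others_wit|.+1 = k.
  rewrite card_in_imset => [|i j]; last first.
    by rewrite !inE => /andP[ik _] /andP[jk _]; apply: einj.
  have -> : [set i : 'I_L | (i < k) && (i != j0)] = [set i : 'I_L | i < k] :\ j0.
    by apply/setP=> i; rewrite !inE andbC.
  have -> : [set i : 'I_L | i < k] = [set widen_ord kL i | i in 'I_k].
    apply/setP => i; rewrite inE; apply/idP/imsetP => [ik|[i' _ ->]//=].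
    by exists (Ordinal ik) => //; apply: val_inj.
  have := cardsD1 j0 [set widen_ord kL i | i in 'I_k].
  rewrite card_imset ?card_ord; last by move=> i j /(congr1 val)/= ?; apply: val_inj.
  have -> : j0 \in [set widen_ord kL i | i in 'I_k].
    by apply/imsetP; exists (Ordinal j0k) => //; apply: val_inj.
  by move=> kE; rewrite -add1n -kE.
(* If e0 is lowered, it remains the witness of its set, at time y. *)
case: (ltnP #|window a y| k) => [wk|kw].
  have winE : window a y = others_wit.
    by apply/esym/eqP; rewrite eqEcard wit_window; move: wk; rewrite -card_wit; clear; lia.
  have nlA0 : linked a (A j0 :\ e0).
    case: le0 => // lA0; case: (lA0 e0 e0A) => [|[q qA tq]]; first by rewrite te0; clear; lia.
    have : q \in window a y by rewrite inE; move: tq; rewrite te0; clear; lia.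
    rewrite winE => /imsetP[i]; rewrite inE => /andP[ik ij] qi.
    case/eqP: ij; apply: (disA _ _ q) => //; rewrite qi; by case: (eP i ik).
  have unmoved p : p != e0 -> step k y a p = a p.
    by move=> /early/negbTE pe; rewrite ffunE pe.
  have notA i : i != j0 -> e0 \notin A i.
    by apply: contraNN => eA; apply/eqP; apply: disA eA e0A.
  have lstep R : e0 \notin R -> linked a R -> linked (step k y a) R.
    move=> eR; apply: eq_linked => p pR; rewrite unmoved //.
    by apply: contraNneq eR => <-.
  have timeS p : p != e0 -> time (step k y a) p = time a p.
    by move=> /early/negbTE pe; rewrite time_step pe.
  have timeS0 : time (step k y a) e0 = y by rewrite time_step te0 eqxx wk.
  exists A; split=> // [i p pA|i ki|i ik].
  - case: (altP (p =P e0)) => [->|pe]; first by rewrite timeS0; move: yM; clear; lia.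
    by rewrite timeS //; apply: timeA pA.
  - apply: lstep (lA i ki); apply: notA; apply: contraTneq ki => ->; rewrite -ltnNge;
    exact: j0k.
  - case: (altP (i =P j0)) => [->|ij].
      exists e0; split=> //; first by rewrite timeS0; move: n0; clear; lia.
      by right; apply: lstep => //; rewrite !inE eqxx.
    have [eA te le] := eP i ik; have ei : e i != e0.
      by apply: contraNneq (notA i ij) => <-.
    exists (e i); split=> //; first by rewrite timeS // windowW // others.
    have nAe : e0 \notin A i :\ e i by rewrite !inE (negbTE (notA i ij)) andbF.
    by case: le => le; [left|right]; apply: lstep => //; apply: notA.
have -> : step k y a = a.
  by apply/ffunP=> p; rewrite ffunE [X in _ && X]ltnNge kw andbF.
(* An element of A j0 in the window replaces e0 as witness. *)
have [q /andP[qA qw]|no_q] := pickP [pred q | (q \in A j0) && (q \in window a y)].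
  exists A; split=> // i ik; case: (altP (i =P j0)) => [->|ij].
    by exists q; split=> //; [apply: windowW|left; apply: linked_window qw].
  exists (e i); case: (eP i ik) => eA te le; split=> //.
  by rewrite windowW // others.
have {}le0 : linked a (A j0 :\ e0).
  case: le0 => // lA0; case: (lA0 e0 e0A) => [|[q qA tq]]; first by rewrite te0; clear; lia.
  by have := no_q q; rewrite /= qA inE; move: tq; rewrite te0; clear; lia.
have [g gw gwit] : exists2 g, g \in window a y & forall i : 'I_L, i < k -> i != j0 -> e i != g.
  have /subsetPn[g gw gwit] : ~~ (window a y \subset others_wit).
    by apply: contraTN kw => /subset_leq_card; rewrite -card_wit; clear; lia.
  exists g => // i ik ij; apply: contraNneq gwit => <-.
  by apply: imset_f; rewrite inE ik.
have gA0 : g \notin A j0.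
  by apply/negP => gA; have := no_q g; rewrite /= gA gw.
have ge0 : g != e0 := window_neq te0 gw.
(* Exchange the owners of e0 and f; a free f leaves e0 free. The set A j0 gets
   f as a witness, and the previous owner of f keeps another one, q. *)
have exchange f : f \in window a y -> f \notin A j0 ->
    (forall i : 'I_L, i != j0 -> f \in A i -> i < k /\ linked a (e0 |: A i :\ f)
       /\ exists2 q, q \in window a y & q \in e0 |: A i :\ f) ->
  chains h k y M a.
  move=> fw fA0 fA.
  exists (fun i => tperm e0 f @^-1: A i).
  have notA i : i != j0 -> e0 \notin A i.
    by apply: contraNN => eA; apply/eqP; apply: disA eA e0A.
  have same i : i != j0 -> f \notin A i -> tperm e0 f @^-1: A i = A i.
    move=> ij fi; apply/setP => p; rewrite inE; case: tpermP => // ->.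
      by rewrite (negbTE fi) (negbTE (notA i ij)).
    by rewrite (negbTE fi) (negbTE (notA i ij)).
  have moved i : i != j0 -> f \in A i -> tperm e0 f @^-1: A i = e0 |: A i :\ f.
    move=> ij fi; apply/setP => p; rewrite !inE; case: tpermP => [->|->|/eqP pe /eqP pf].
    - by rewrite fi eqxx.
    - rewrite (negbTE (notA i ij)) eqxx andFb orbF; apply/esym/eqP => fe.
      by have := window_neq te0 fw; rewrite fe eqxx.
    - by rewrite (negbTE pe) pf.
  have moved0 : tperm e0 f @^-1: A j0 = f |: A j0 :\ e0.
    apply/setP => p; rewrite !inE; case: tpermP => [->|->|/eqP pe /eqP pf].
    - rewrite (negbTE fA0) eqxx andFb orbF; apply/esym/eqP => fe.
      by have := window_neq te0 fw; rewrite -fe eqxx.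
    - by rewrite e0A eqxx.
    - by rewrite (negbTE pf) pe.
  split=> [i j p||i p|i ki|i ik].
  - by rewrite !inE; apply: disA.
  - by move=> i; rewrite card_preimset //; apply: perm_inj.
  - rewrite inE; case: tpermP => [->|->|_ _ /timeA//] _; first by rewrite te0.
    by apply: ltn_trans yM; case/andP: (windowW fw).
  - case: (altP (i =P j0)) => [ij|ij]; first by move: ki; rewrite ij leqNgt j0k.
    case: (boolP (f \in A i)) => fi; first by have [] := fA i ij fi; rewrite ltnNge ki.
    by rewrite same //; apply: lA.
  - case: (altP (i =P j0)) => [->|ij].
      rewrite moved0; exists f; rewrite setU11; split=> //.
        exact: windowW.
      right; suff -> : (f |: A j0 :\ e0) :\ f = A j0 :\ e0 by [].
      by rewrite setU1K // !inE negb_and fA0 orbT.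
    case: (boolP (f \in A i)) => fi.
      have [_ [lf [q qw qf]]] := fA i ij fi; exists q; rewrite moved //.
      by split=> //; [apply: windowW|left].
    exists (e i); rewrite same //; case: (eP i ik) => eA te le; split=> //.
    by rewrite windowW // others.
have [i gA|free] := pickP (fun i => g \in A i); last first.
  by apply: exchange gw gA0 _ => i _; rewrite free.
have ij : i != j0 by apply: contraTneq gA => ->.
(* If g belongs to a set with a witness of its own, the element of this set to
   be exchanged is its latest in the window, so that what it was linking gets
   linked to e0. *)
case: (ltnP i k) => [ik|ki].
  have lAi : linked a (A i).
    have [eA _ le] := eP i ik; have ew := others i ik ij.
    case: le => // le; apply: (@linked_add a _ (e i) g) => //.
      by rewrite eq_sym; apply: gwit.
    exact: (window_close ew gw).
  pose inside := [pred p | (p \in A i) && (p \in window a y)].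
  have gin : inside g by rewrite /= gA gw.
  case: (@arg_maxnP _ g inside (time a) gin) => f /andP[fA fw] fmax.
  have fi' : exists2 f', inside f' & f' != f.
    have [eA _ _] := eP i ik; case: (altP (g =P f)) => [gf|gf]; last by exists g.
    by exists (e i); [rewrite /= eA others|rewrite -gf; apply: gwit].
  have [f' /andP[f'A f'w] f'f] := fi'.
  apply: (exchange f) => // [|i1 _ fi1].
    by apply/negP => fA0; have := no_q f; rewrite /= fA0 fw.
  have -> : i1 = i by apply: disA fi1 fA.
  split=> //; split; last by exists f'; rewrite // !inE f'f f'A orbT.
  move=> p; rewrite in_setU1 in_setD1 => /orP[/eqP->|/andP[pf pA]].
    right; exists f'; first by rewrite !inE f'f f'A orbT.
    exact: (window_next te0 f'w).
  have [|[q qA tq]] := lAi p pA; first by left.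
  right; case: (altP (q =P f)) => [qf|qf]; last by exists q; rewrite // !inE qf qA orbT.
  exists e0; first by rewrite setU11.
  have tfp : time a f < time a p by rewrite -qf; case/andP: tq.
  have : ~~ inside p by apply/negP => /fmax /=; rewrite leqNgt tfp.
  rewrite /= pA /= inE; move: fw tq tfp; rewrite inE te0 qf.
  have : time a p != y + n by apply: early; apply: contraTneq pA => ->; apply/negP => eA;
    case/eqP: ij; apply: disA eA e0A.
  by clear; lia.
(* If g belongs to a set A i without witness, A i is smaller than A j0. An early
   part Q of A j0 of the right size becomes the i-th set, and A i with the rest
   of A j0 becomes the j0-th one, with witness g. *)
have card_Q : #|A j0 :\ e0| = s.-1.
  by have := cardsD1 e0 (A j0); rewrite e0A cardA hk // => ->.
have hi : h i < s := hnk i ki.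
have [|Q [QA cQ lQ]] := @linked_trunc n a (A j0 :\ e0) (h i) le0;
  first by rewrite card_Q -ltnS prednK // (leq_trans _ hi).
have QA0 : Q \subset A j0 by apply: subset_trans QA (subsetDl _ _).
have early_A0 p : p \in A j0 :\ e0 -> time a p <= y.
  have [m] := ubnP (time a p); elim: m p => // m IH p pm pA.
  have [|[q qA tq]] := le0 p pA.
    move=> pn; rewrite leqNgt; apply/negP => yp.
    have := no_q p; rewrite /= inE; move: pA; rewrite !inE => /andP[_ ->].
    by rewrite yp (leq_trans pn) // leq_addl.
  have yq : time a q <= y by apply: IH => //; case/andP: tq => qp _; apply: leq_trans qp _.
  rewrite leqNgt; apply/negP => yp.
  have := no_q p; rewrite /= inE; move: pA; rewrite !inE => /andP[_ ->].
  by move: tq yq yp; clear; lia.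
have ltg p : p \in A j0 :\: Q -> time a p < time a g + n.
  move: gw; rewrite inE => gw; rewrite inE => /andP[_ pA].
  case: (altP (p =P e0)) => [->|pe]; first by rewrite te0; move: gw; clear; lia.
  have : time a p <= y by apply: early_A0; rewrite !inE pe.
  by move: gw; clear; lia.
exists (fun l => if l == j0 then A i :|: A j0 :\: Q else if l == i then Q else A l).
split=> [l1 l2 p|l|l p|l kl|l lk].
- have pQ : p \in Q -> p \in A j0 by move/(subsetP QA0).
  have ji : p \in A i -> p \in A j0 -> False.
    by move=> pi pj; case/eqP: ij; apply: disA pi pj.
  have owner l : p \in (if l == j0 then A i :|: A j0 :\: Q else if l == i then Q else A l) ->
      if (p \in A i) || (p \in A j0) then l = (if p \in Q then i else j0) else p \in A l.
    case: eqP => [->|lj]; last case: eqP => [->|li].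
    - rewrite !inE => /orP[pi|/andP[/negbTE-> ->]]; rewrite ?orbT // pi.
      by case: ifP => // /pQ /(ji pi).
    - by move=> pQ'; rewrite pQ' pQ ?orbT.
    - move=> pl; case: orP => // -[pi|pj]; [case: li|case: lj]; exact: disA pl _.
  move=> /owner + /owner; case: ifP => _; first by move=> -> ->.
  exact: disA.
- case: eqP => [->|_]; last by case: eqP => [->|].
  rewrite cardsU cardsD (setIidPr QA0) cQ !cardA (hk _ j0k).
  have -> : A i :&: (A j0 :\: Q) = set0; last by rewrite cards0; move: hi; clear; lia.
  apply/setP => p; rewrite !inE; apply/negP => /and3P[pi _ pj].
  by case/eqP: ij; apply: disA pi pj.
- case: eqP => _; last by case: eqP => _; [move/(subsetP QA0)|]; apply: timeA.
  by rewrite !inE => /orP[|/andP[_]]; apply: timeA.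
- case: eqP => [lj|_]; first by move: kl; rewrite lj leqNgt j0k.
  by case: eqP => [_|_]; last exact: lA.
- case: eqP => [lj|/eqP lj].
    exists g; rewrite inE gA; split=> //; first exact: windowW.
    by left; apply: linkedU (lA i ki) gA ltg.
  case: eqP => [li|_]; first by move: lk; rewrite li ltnNge ki.
  have [eA te le] := eP l lk; exists (e l); split=> //.
  by rewrite windowW // others.
Qed.
End StepChains.

(** * Sweeps: an injection on words *)

Section Sweeps.
Variable n : nat.
Implicit Types (a b c : {ffun 'I_n -> nat}) (p q e f g : 'I_n) (A R : {set 'I_n}).

Fixpoint sweep k y a := if y is y'.+1 then sweep k y' (step k y' a) else a.

Lemma sweep_chains L (h : 'I_L -> nat) k s M y a :
  k <= L -> (forall i : 'I_L, i < k -> h i = s) ->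
  (forall i : 'I_L, k <= i -> h i < s) -> y + n <= M ->
  chains h k y M a -> chains h k 0 M (sweep k y a).
Proof.
move=> kL hk hnk; elim: y a => //= y IH a yM ca.
by apply: IH; [lia|apply: step_chains hnk _ ca].
Qed.

Lemma sweep_inj L (h : 'I_L -> nat) k s M y a b :
  k <= L -> (forall i : 'I_L, i < k -> h i = s) ->
  (forall i : 'I_L, k <= i -> h i < s) -> y + n <= M ->
  chains h k y M a -> chains h k y M b ->
  sweep k y a = sweep k y b -> a = b.
Proof.
move=> kL hk hnk; elim: y a b => //= y IH a b yM ca cb /IH eq_step.
apply: step_inj (chains_witness kL ca) (chains_witness kL cb) _.
by apply: eq_step; [lia| |]; apply: step_chains hnk _ _.
Qed.

(** A sweep from y <= n * r meets only times at most y + n, that is letters at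
    most r. *)
Lemma sweep_letter k r y a p : y <= n * r ->
  (r < a p -> sweep k y a p = a p) /\ (a p <= r -> sweep k y a p <= r).
Proof.
elim: y a => //= y IH a yr; have [IH1 IH2] := IH (step k y a) (ltnW yr).
have n0 : 0 < n := leq_ltn_trans (leq0n _) (ltn_ord p).
have : step k y a p = a p \/ a p <= r /\ step k y a p <= r.
  rewrite ffunE; case: ifP => [/andP[/eqP tp _]|]; last by left.
  suff ar : a p <= r by right; lia.
  by rewrite -(time_divn a p) tp -ltnS ltn_divLR //; lia.
case=> [sE|[ar sr]]; first by rewrite sE in IH1 IH2.
by split=> [|_]; [lia|apply: IH2].
Qed.

Variable m : nat -> nat.
Hypothesis m_mono : forall r, m r.+1 <= m r.

Fixpoint sweeps r a := if r is r'.+1 then sweep (m r') (n * r') (sweeps r' a) else a.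

(** The size reached by the i-th set after r stages. *)
Definition height r (i : nat) := \sum_(r' < r) (i < m r').

Lemma sweeps_letter r a p :
  (r <= a p -> sweeps r a p = a p) /\ (a p < r -> sweeps r a p < r).
Proof.
elim: r => //= r [IH1 IH2].
have [ge le] := sweep_letter (m r) (sweeps r a) p (leqnn (n * r)).
split=> [ar|]; first by rewrite ge // IH1 //; lia.
rewrite ltnS leq_eqVlt => /orP[/eqP ar|/IH2 ar]; apply: le; last by lia.
by rewrite IH1 ar.
Qed.

Lemma m_antimono r r' : r <= r' -> m r' <= m r.
Proof. by move/subnK<-; elim: (r' - r) => //= d; apply: leq_trans; rewrite addSn. Qed.

Lemma height_full r i : i < m r -> height r.+1 i = r.+1.
Proof.
move=> ir; rewrite /height (eq_bigr (fun=> 1)) ?sum_nat_const ?card_ord ?muln1 //.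
by move=> r' _; rewrite (leq_trans ir) // m_antimono // -ltnS.
Qed.

Lemma heightS r i : height r.+1 i = height r i + (i < m r).
Proof. by rewrite /height big_ord_recr. Qed.

Lemma height_le r i : height r i <= r.
Proof.
rewrite -[X in _ <= X]card_ord -sum1_card; apply: leq_sum => r' _; exact: leq_b1.
Qed.

(** With m r = la_r these are the words of X. *)
Definition rich s c := forall r, r < s -> m r <= #|[set p | c p == r]|.

(** At stage r the first m r sets each receive a position of letter r; the
    letters of the earlier stages are below r, so these positions are new and of
    later times. *)
Lemma chains_start r a : m r <= #|[set p | a p == r]| ->
  @chains n (m 0) (fun i => height r i) 0 0 (n * r) a ->
  @chains n (m 0) (fun i => height r.+1 i) (m r) (n * r) (n * r.+1) a.
Proof.
move=> mr [A [disA cardA timeA lA _]].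
have m0 : m r <= m 0 by apply: m_antimono.
pose B (i : 'I_(m 0)) := if insub (i : nat) is Some j then [set enum_val (widen_ord mr j)]
  else set0.
have BE (i : 'I_(m 0)) (ir : i < m r) : B i = [set enum_val (widen_ord mr (Ordinal ir))].
  by rewrite /B insubT.
have B0 (i : 'I_(m 0)) : m r <= i -> B i = set0.
  by move=> ir; rewrite /B insubF //; lia.
have tokr (j : 'I_(m r)) : a (enum_val (widen_ord mr j)) = r.
  by have := enum_valP (widen_ord mr j); rewrite inE => /eqP.
have aB i p : p \in B i -> a p = r.
  by rewrite /B; case: insubP => [j _ _ /set1P->|]; rewrite ?tokr // inE.
have aA i p : p \in A i -> a p < r.
  move/timeA => tp; have n0 : 0 < n := leq_ltn_trans (leq0n _) (ltn_ord p).
  by rewrite -(time_divn a p) ltn_divLR //; lia.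
have disB i j p : p \in B i -> p \in B j -> i = j.
  case: (ltnP i (m r)) => ir; last by rewrite B0 // inE.
  case: (ltnP j (m r)) => jr; last by rewrite (B0 j) // inE.
  rewrite !BE => /set1P-> /set1P/enum_val_inj/(congr1 val)/= ij; exact: val_inj.
have AB i j p : p \in A i -> p \in B j -> False by move=> /aA + /aB; lia.
exists (fun i => A i :|: B i); split=> [i j p|i|i p|i ri|i ir].
- rewrite !inE => /orP[pi|pi] /orP[pj|pj]; [exact: disA pi pj| | |exact: disB pi pj].
    by case: (AB _ _ _ pi pj).
  by case: (AB _ _ _ pj pi).
- have AB0 : A i :&: B i = set0.
    by apply/setP=> p; rewrite !inE; apply/negP => /andP[pi /(AB _ _ _ pi)].
  rewrite cardsU AB0 cards0 subn0 cardA heightS.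
  case: ltnP => ir; first by rewrite BE cards1.
  by rewrite B0 ?cards0.
- rewrite inE => /orP[/timeA|/aB ap]; first by rewrite mulnS; lia.
  by rewrite /time ap mulnS; have := ltn_ord (rev_ord p); lia.
- by rewrite B0 // setU0; apply: lA.
- exists (enum_val (widen_ord mr (Ordinal ir))); rewrite BE.
  split; first by rewrite !inE eqxx orbT.
    by rewrite /time tokr; have := ltn_ord (rev_ord (enum_val (widen_ord mr (Ordinal ir))));
      lia.
  right; rewrite setUC setU1K; first exact: lA.
  by apply/negP => /aA; rewrite tokr ltnn.
Qed.

Lemma chains_end L (h : 'I_L -> nat) k M a : chains h k 0 M a -> chains h 0 0 M a.
Proof.
case=> A [disA cardA timeA lA wA]; exists A; split=> // i _.
case: (ltnP i k) => [ik|]; last exact: lA.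
have [e [eA te [//|le]] p pA] := wA i ik.
case: (altP (p =P e)) => [->|pe]; first by left.
have pAe : p \in A i :\ e by rewrite !inE pe.
have [pn|[q]] := le p pAe; first by left.
by rewrite !inE => /andP[_ qA] tq; right; exists q.
Qed.

Lemma rich_sweeps r c : m r <= #|[set p | c p == r]| ->
  m r <= #|[set p | sweeps r c p == r]|.
Proof.
suff -> : [set p | sweeps r c p == r] = [set p | c p == r] by [].
apply/setP => p; rewrite !inE; have [ge lt] := sweeps_letter r c p.
by case: (ltnP (c p) r) => cr; [have := lt cr|rewrite ge]; lia.
Qed.

Lemma sweep_stage r a : m r <= #|[set p | a p == r]| ->
  @chains n (m 0) (fun i => height r i) 0 0 (n * r) a ->
  @chains n (m 0) (fun i => height r.+1 i) (m r) 0 (n * r.+1) (sweep (m r) (n * r) a).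
Proof.
move=> mr ca; apply: (@sweep_chains _ _ _ r.+1) (chains_start mr ca).
- exact: m_antimono.
- by move=> i; apply: height_full.
- by move=> i ri; rewrite heightS [_ < m r]ltnNge ri addn0 ltnS height_le.
- by rewrite mulnS; lia.
Qed.

Lemma sweeps_chains s c : rich s c ->
  @chains n (m 0) (fun i => height s i) 0 0 (n * s) (sweeps s c).
Proof.
elim: s => [|r IH] mc.
  exists (fun=> set0); split=> //; rewrite /height.
  - by move=> i j p; rewrite inE.
  - by move=> i; rewrite cards0 big_ord0.
  - by move=> i p; rewrite inE.
  - by move=> i _ p; rewrite inE.
apply: chains_end; apply: sweep_stage; first by apply/rich_sweeps/mc.
by apply: IH => r' r'r; apply: mc; lia.
Qed.

Lemma sweeps_inj s b c : rich s b -> rich s c ->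
  sweeps s b = sweeps s c -> b = c.
Proof.
elim: s => //= r IH mb mc eqbc.
have mb' : rich r b by move=> r' ?; apply: mb; lia.
have mc' : rich r c by move=> r' ?; apply: mc; lia.
apply: IH => //; move: eqbc.
apply: (@sweep_inj (m 0) (fun i => height r.+1 i) _ r.+1 (n * r.+1)).
- exact: m_antimono.
- by move=> i; apply: height_full.
- by move=> i ri; rewrite heightS [_ < m r]ltnNge ri addn0 ltnS height_le.
- by rewrite mulnS; lia.
- by apply: chains_start; [apply/rich_sweeps/mb|apply: sweeps_chains].
- by apply: chains_start; [apply/rich_sweeps/mc|apply: sweeps_chains].
Qed.
End Sweeps.

(** * Ranking the indices of a family of integers *)

Section Ranking.
Variables (m : nat) (a : 'I_m -> nat).

(** Decreasing order of the values of a, ties being broken by the index. *)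
Definition before (q p : 'I_m) := (a p < a q) || (a q == a p) && (q < p).
Definition ranking p := #|[set q | before q p]|.

Lemma before_irr p : before p p = false.
Proof. by rewrite /before !ltnn andbF. Qed.

Lemma before_total q p : q != p -> before q p || before p q.
Proof. by rewrite /before -val_eqE /=; lia. Qed.

Lemma ranking_before q p : before q p -> ranking q < ranking p.
Proof.
move=> qp; apply: proper_card; apply/properP; split.
  by apply/subsetP => r; rewrite !inE; move: qp; rewrite /before; lia.
by exists q; rewrite inE // before_irr.
Qed.

Lemma ranking_lt p : ranking p < m.
Proof.
rewrite -[X in _ < X]card_ord -cardsT; apply: proper_card.
by apply/properP; split; [apply: subsetT|exists p; rewrite // inE before_irr].
Qed.

Lemma ranking_inj : injective (fun p => Ordinal (ranking_lt p)).
Proof.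
move=> p q /(congr1 val) /= eqr; apply/eqP; apply: contraT => /before_total.
by case/orP => /ranking_before; rewrite eqr ltnn.
Qed.

Lemma ranking_perm : exists sigma : 'S_m, forall l, ranking (sigma l) = l.
Proof.
exists (perm ranking_inj)^-1%g => l.
by have := permKV (perm ranking_inj) l; rewrite permE => /(congr1 val).
Qed.
End Ranking.

(** * Descent words *)

Lemma enum_val_ltn n (A : {set 'I_n}) (i j : 'I_#|A|) :
  (enum_val i < enum_val j) = (i < j).
Proof.
suff H (k l : 'I_#|A|) : k < l -> enum_val k < enum_val l.
  case: (ltngtP i j) => [/H->//|/H|/val_inj->]; last by rewrite ltnn.
  by case: ltngtP.
move=> kl; pose x0 := enum_val k.
have lt_trans : transitive (relpre (val : 'I_n -> nat) ltn) by move=> a b c; apply: ltn_trans.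
have sortedA : sorted (relpre (val : 'I_n -> nat) ltn) (enum A).
  rewrite {1}/enum_mem; apply: sorted_filter => //.
  by rewrite -sorted_map -enumT val_enum_ord iota_ltn_sorted.
rewrite (enum_val_nth x0 k) (enum_val_nth x0 l).
by apply: (sorted_ltn_nth lt_trans x0 sortedA) => //; rewrite inE -cardE.
Qed.

(** The exponent of the variable of index sigma l in the descent monomial. *)
Definition descents_from m (sigma : 'S_m) (l : nat) :=
  \sum_(ii : 'I_m * 'I_m | (ii.2 == ii.1.+1 :> nat) && (sigma ii.2 < sigma ii.1))
    (l <= ii.1).

Lemma descent_monomialE m (sigma : 'S_m) : descent_monomial sigma =
  'X_[ [multinom descents_from sigma ((sigma^-1)%g p) | p < m] ].
Proof.
rewrite /descent_monomial.
under eq_bigr do rewrite mprodXE.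
rewrite mprodXE; congr mpolyX; apply/mnmP => p; rewrite mnmE mnm_sumE.
apply: eq_bigr => ii _; rewrite mnm_sumE.
under eq_bigr do rewrite mnm1E.
case: leqP => le.
  rewrite (bigD1 ((sigma^-1)%g p)) //= permKV eqxx big1 // => l /andP[_ ne].
  by rewrite -(inj_eq (@perm_inj _ (sigma^-1)%g)) permK (negbTE ne).
rewrite big1 // => l ll; rewrite -(inj_eq (@perm_inj _ (sigma^-1)%g)) permK.
by case: eqP => // lE; rewrite lE leqNgt le in ll.
Qed.

Lemma descents_fromS m (sigma : 'S_m) (i j : 'I_m) : j = i.+1 :> nat ->
  descents_from sigma i = descents_from sigma j + (sigma j < sigma i).
Proof.
move=> ji; rewrite /descents_from ji.
rewrite (eq_bigr (fun ii : 'I_m * 'I_m => (i.+1 <= ii.1) + (ii == (i, j)))); last first.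
  case=> i1 i2 /= /andP[/eqP i2E _]; rewrite xpair_eqE -!val_eqE /= i2E ji eqSS.
  by rewrite (leq_eqVlt i) eq_sym; case: ltngtP.
rewrite big_split /=; congr (_ + _).
case: ltnP => desc.
  by rewrite (bigD1 (i, j)) /= ?ji ?eqxx //= big1 // => ii /andP[_ /negbTE->].
rewrite big1 // => -[i1 i2] /= /andP[_]; case: eqP => // -[-> ->].
by rewrite ltnNge desc.
Qed.

Lemma descents_from_last m (sigma : 'S_m) (i : 'I_m) : i.+1 = m ->
  descents_from sigma i = 0.
Proof.
move=> im; rewrite /descents_from big1 // => -[i1 i2] /= /andP[/eqP i2E _].
by have := ltn_ord i2; rewrite leqNgt ltnS; have := ltn_ord i1; lia.
Qed.

Lemma descent_wordP m (a : 'X_{1..m}) : descent_word a <->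
  exists sigma : 'S_m, forall l, a (sigma l) = descents_from sigma l.
Proof.
split=> -[sigma aE]; exists sigma.
  move=> l; have := congr1 (mcoeff a) aE.
  rewrite descent_monomialE !mcoeffX eqxx; case: eqP => [<- _|_ /eqP].
    by rewrite mnmE permK.
  by rewrite GRing.oner_eq0.
rewrite descent_monomialE; congr mpolyX; apply/mnmP => p.
by rewrite mnmE -aE permKV.
Qed.

(** List the indices by decreasing letter, equal letters by increasing index.
    A pair q < r with letters v - 1 and v says that the last v lies to the right
    of the first v - 1, so that the list has a descent where the letter drops, and it
    drops by one. *)
Lemma descent_word_of_pairs m (a : 'X_{1..m}) :
  (forall p, a p = 0 \/ exists q r : 'I_m, [/\ q < r, (a q).+1 = a r & a r = a p]) ->
  descent_word a.
Proof.
move=> good; apply/descent_wordP.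
have [sigma rankK] := ranking_perm a; exists sigma.
have beforeE l l' : before a (sigma l) (sigma l') = (l < l').
  apply/idP/idP => [/ranking_before|ll]; first by rewrite !rankK.
  have /(before_total a)/orP[//|/ranking_before] : sigma l != sigma l'.
    by rewrite (inj_eq perm_inj) -val_eqE neq_ltn ll.
  by rewrite !rankK ltnNge (ltnW ll).
have sigmaP p : exists l, p = sigma l by exists ((sigma^-1)%g p); rewrite permKV.
have last_step (l : 'I_m) : l.+1 = m -> a (sigma l) = 0.
  move=> lm; have [//|[q [r [_ qr rp]]]] := good (sigma l).
  have [k qE] := sigmaP q; have : before a (sigma l) q by rewrite /before; lia.
  by rewrite qE beforeE; have := ltn_ord k; lia.
have next_step (l l' : 'I_m) : l' = l.+1 :> nat ->
    a (sigma l) = a (sigma l') + (sigma l' < sigma l).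
  move=> ll'; have := beforeE l l'; rewrite ll' ltnSn.
  have between x : before a (sigma l) x -> x = sigma l' \/ before a (sigma l') x.
    have [k ->] := sigmaP x; rewrite !beforeE ll' leq_eqVlt => /orP[/eqP kE|]; last by right.
    by left; congr (sigma _); apply: val_inj; rewrite /= ll'.
  have outside x : before a x (sigma l') -> x = sigma l \/ before a x (sigma l).
    have [k ->] := sigmaP x; rewrite !beforeE ll' ltnS leq_eqVlt => /orP[/eqP kE|];
      last by right.
    by left; congr (sigma _); apply: val_inj.
  rewrite {1}/before => /orP[alt|/andP[/eqP-> lt]]; last first.
    by rewrite ltnNge ltnW // addn0.
  have [a0|[q [r [qr aqr rp]]]] := good (sigma l); first by rewrite a0 in alt.
  have aq : a (sigma l') = a q /\ sigma l' <= q.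
    have [|->//|] := between q; first by rewrite /before; lia.
    by rewrite /before; lia.
  have rl : r <= sigma l.
    have [|->//|] := outside r; first by rewrite /before; lia.
    by rewrite /before; lia.
  by case: aq => aq lq; rewrite (leq_ltn_trans lq (leq_trans qr rl)); lia.
move=> l; have [d dE] := ubnP (m - l); elim: d l dE => // d IH l dE.
case: (ltnP l.+1 m) => lm; last first.
  by rewrite last_step ?descents_from_last //; have := ltn_ord l; lia.
rewrite (next_step l (Ordinal lm)) // (@descents_fromS _ _ l (Ordinal lm)) //.
by rewrite IH //=; lia.
Qed.

Section LinkedWords.
Variable n : nat.
Implicit Types (a : {ffun 'I_n -> nat}) (A : {set 'I_n}).

(** For r the rightmost position of its letter in A, a predecessor of r must have
    the letter below, and hence lie to the left of r. *)
Lemma linked_pairs a A p : linked a A -> p \in A ->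
  a p = 0 \/ exists q r : 'I_n, [/\ q \in A, r \in A & [/\ q < r, (a q).+1 = a r & a r = a p]].
Proof.
move=> lA pA; have n0 : 0 < n := leq_ltn_trans (leq0n _) (ltn_ord p).
have pP : [pred x | (x \in A) && (a x == a p)] p by rewrite /= pA eqxx.
case: (@arg_minnP _ p [pred x | (x \in A) && (a x == a p)] (time a) pP).
move=> r /andP[rA /eqP rp] rmin.
have [rn|[q qA /andP[qr rq]]] := lA r rA.
  by left; rewrite -rp -(time_divn a r) divn_small.
right; exists q, r; split=> //.
have qr' : a q <= a r by rewrite -!(time_divn a) leq_div2r // ltnW.
have rq' : a r <= (a q).+1.
  have <- : (time a q + n) %/ n = (a q).+1 by rewrite divnDr ?dvdnn // time_divn divnn n0
    addn1.
  by rewrite -[a r]time_divn leq_div2r // ltnW.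
have aqr : a q != a r.
  apply: contraTneq qr => aqr; rewrite -leqNgt; apply: rmin.
  by rewrite /= qA aqr rp eqxx.
have aqE : (a q).+1 = a r by lia.
split=> //; move: rq; rewrite /time -aqE mulnS /=.
by have := ltn_ord q; have := ltn_ord r; lia.
Qed.

Lemma linked_descent_word a (b : 'X_{1..n}) A :
  (forall p, b p = a p) -> linked a A -> descent_word (restrict b A).
Proof.
move=> ba lA; apply: descent_word_of_pairs => i; rewrite mnmE ba.
have [->|[q [r [qA rA [qr aqr rp]]]]] := linked_pairs lA (enum_valP i); first by left.
right; exists (enum_rank_in qA q), (enum_rank_in rA r).
by rewrite -enum_val_ltn !mnmE !ba !enum_rankK_in.
Qed.
End LinkedWords.

Lemma descents_from_le m (sigma : 'S_m) (l : 'I_m) :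
  descents_from sigma l <= rev_ord l.
Proof.
have [d dE] := ubnP (m - l); elim: d l dE => // d IH l dE.
case: (ltnP l.+1 m) => lm; last first.
  by rewrite descents_from_last //; have := ltn_ord l; lia.
rewrite (@descents_fromS _ _ l (Ordinal lm)) //.
have := IH (Ordinal lm); have := leq_b1 (sigma (Ordinal lm) < sigma l).
move: (nat_of_bool _) => x; rewrite /=; move: dE lm; clear; lia.
Qed.

(** From l + 1 to l the complement rev_ord l - descents_from sigma l either stays,
    at a descent, where the position increases, or grows by one, which outweighs
    any change of position. *)
Lemma descents_from_lt m n (sigma : 'S_m) (pos : 'I_m -> nat) :
  (forall l, pos l < n) -> (forall l l', (pos l' < pos l) = (sigma l' < sigma l)) ->
  forall l l' : 'I_m, l < l' ->
  n * (rev_ord l' - descents_from sigma l') + pos l' <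
    n * (rev_ord l - descents_from sigma l) + pos l.
Proof.
move=> posn pos_sigma; pose y l := n * (rev_ord l - descents_from sigma l) + pos l.
have y_step (l l' : 'I_m) : l' = l.+1 :> nat -> y l' < y l.
  move=> ll'; have := descents_from_le sigma l'.
  rewrite /y (descents_fromS _ ll') -pos_sigma.
  move: (descents_from _ _) (posn l) (posn l') (ltn_ord l') => x.
  rewrite /= ll'; case: (ltnP (pos l') (pos l)) => /= + pn p'n lm xm.
    by rewrite (_ : m - l.+1 - (x + 1) = m - l.+2 - x) ?ltn_add2l //; lia.
  move=> _; rewrite (_ : m - l.+1 - (x + 0) = (m - l.+2 - x).+1); last by lia.
  by rewrite mulnS addnAC addnC ltn_add2r ltn_addr.
move=> l l'; rewrite -/(y l) -/(y l').
have [d dE] := ubnP (l' - l); elim: d l dE => // d IH l dE ll'.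
have lm : l.+1 < m by apply: leq_ltn_trans ll' (ltn_ord l').
apply: leq_trans (y_step l (Ordinal lm) erefl); rewrite ltnS.
case: (ltngtP l.+1 l') => [ll|ll|ll].
- by apply/ltnW/IH => //=; lia.
- by lia.
- by rewrite (_ : Ordinal lm = l') //; apply: val_inj.
Qed.

(** The values delta complete the descent word to a bijection onto
    {0, ..., #|A| - 1}, sorted so that delta and n * (delta - b) + position
    increase together. *)
Lemma descent_block n (A : {set 'I_n}) (b : 'X_{1..n}) :
  descent_word (restrict b A) -> exists delta : 'I_n -> nat,
  [/\ forall p, p \in A -> b p <= delta p < #|A|,
      {in A &, injective delta} &
      {in A &, forall p q, delta q < delta p ->
         n * (delta q - b q) + q < n * (delta p - b p) + p}].
Proof.
move=> /descent_wordP[sigma sigmaE].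
pose at_ l := enum_val (sigma l).
have /fin_all_exists[delta deltaP] : forall p, exists v : nat, p \in A ->
    exists2 l : 'I_#|A|, p = at_ l & v = rev_ord l :> nat.
  move=> p; case: (boolP (p \in A)) => [pA|_]; last by exists 0.
  exists (val (rev_ord ((sigma^-1)%g (enum_rank_in pA p)))) => _.
  by exists ((sigma^-1)%g (enum_rank_in pA p)); rewrite // /at_ permKV enum_rankK_in.
have b_at l : b (at_ l) = descents_from sigma l by rewrite -sigmaE mnmE.
have from_le (l : 'I_#|A|) : descents_from sigma l <= rev_ord l by apply: descents_from_le.
have y_lt : forall l l' : 'I_#|A|, l < l' -> _ :=
  @descents_from_lt _ n sigma at_ (fun l => ltn_ord _)
    (fun l l' => enum_val_ltn (sigma l') (sigma l)).
exists delta; split=> [p /deltaP[l -> ->]|p q /deltaP[l pl dl] /deltaP[l' ql dl'] |].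
- by rewrite b_at from_le ltn_ord.
- by rewrite dl dl' pl ql => /val_inj/rev_ord_inj->.
move=> p q /deltaP[l pl dl] /deltaP[l' ql dl']; rewrite dl dl' pl ql !b_at /= => lt.
apply: y_lt; rewrite ltnNge; apply: contraL lt => le.
by rewrite -leqNgt; apply: leq_sub2l.
Qed.

(** * Transposes and ordered set partitions *)

Section Transpose.
Variables (k : nat) (la : seq nat).
Hypothesis la_part : is_part k la.

Lemma part_mono r : nth 0 la r.+1 <= nth 0 la r.
Proof.
case/and3P: la_part => srt _ _.
case: (ltnP r.+1 (size la)) => rs; last by rewrite nth_default.
have geq_trans : transitive geq by move=> x y z /= xy yz; apply: leq_trans yz xy.
by apply: (sorted_ltn_nth geq_trans 0 srt); rewrite ?inE ?(ltnW rs).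
Qed.

Lemma conj_partE s j : size la <= s ->
  conj_part la j.+1 = \sum_(r < s) (j < nth 0 la r).
Proof.
move=> sla; rewrite /conj_part -sum1_count (big_nth 0) big_mkcond /=.
rewrite -(subnKC sla) -(big_mkord xpredT (fun r => nat_of_bool (j < nth 0 la r))).
rewrite /index_iota !subn0 iotaD big_cat /= [X in _ = _ + X]big1_seq ?addn0.
  by apply: eq_bigr => i _; case: ltnP.
by move=> i; rewrite mem_iota => /andP[_ /andP[le _]];
  rewrite nth_default // -(add0n (size la)).
Qed.

Lemma conj_part_gt0 j : j < head 0 la -> 0 < conj_part la j.+1.
Proof. by rewrite /conj_part; case: (la) => //= x l ->. Qed.

Lemma sum_conj_part : \sum_(i < head 0 la) conj_part la i.+1 = k.
Proof.
case/and3P: la_part => srt _ /eqP <-.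
under eq_bigr do rewrite (conj_partE _ (leqnn _)).
rewrite exchange_big /= sumnE (big_nth 0) big_mkord; apply: eq_bigr => r _.
have rh : nth 0 la r <= head 0 la.
  by rewrite -nth0; elim: (val r) => // j; apply: leq_trans (part_mono j).
rewrite -(big_mkord xpredT (fun i => nat_of_bool (i < nth 0 la r))).
rewrite (big_cat_nat (leq0n _) rh) /=.
have -> : \sum_(0 <= i < nth 0 la r) (i < nth 0 la r) = nth 0 la r.
  rewrite -[RHS]subn0 -[RHS]muln1 -sum_nat_const_nat.
  by apply: eq_big_nat => i /andP[_ ->].
rewrite big_nat_cond big1 ?addn0 // => i /andP[/andP[le _] _].
by rewrite ltnNge le.
Qed.
End Transpose.

Lemma sum_ltn c n x : \sum_(c <= j < n) (j < x) = minn n x - c.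
Proof.
elim: n => [|n IH]; first by rewrite big_geq // min0n.
case: (leqP c n) => cn; last by rewrite big_geq // /minn; case: ifP; lia.
by rewrite big_nat_recr //= IH; case: (ltnP n x) => nx; lia.
Qed.

(** The parts of the transpose decrease, so the sum of any selection that omits at
    most c of them is at least the sum of those beyond the first c. *)
Lemma conj_part_counting n k s (la : seq nat) (Q : pred 'I_(head 0 la)) c :
  is_part k la -> size la <= s -> #|[predC Q]| <= c ->
  \sum_(c.+1 <= j < n.+1) conj_part la j <= \sum_(i | Q i) conj_part la i.+1.
Proof.
move=> lap sla Qc; rewrite big_add1 /=.
under eq_bigr do rewrite (conj_partE _ sla).
under [X in _ <= X]eq_bigr do rewrite (conj_partE _ sla).
rewrite exchange_big [X in _ <= X]exchange_big /=; apply: leq_sum => r _.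
have rh : nth 0 la r <= head 0 la.
  by rewrite -nth0; elim: (val r) => // j; apply: leq_trans (part_mono lap j).
rewrite sum_ltn; apply: (@leq_trans (nth 0 la r - c)); first by rewrite leq_sub2r ?geq_minr.
have xE : \sum_(i < head 0 la) (i < nth 0 la r) = nth 0 la r.
  rewrite -(big_mkord xpredT (fun i => nat_of_bool (i < nth 0 la r))) sum_ltn subn0.
  by apply/minn_idPr.
rewrite leq_subLR -{1}xE (bigID Q) /= addnC leq_add2r.
apply: leq_trans Qc; rewrite -sum1_card; apply: leq_sum => i _; exact: leq_b1.
Qed.

Lemma osp_blocks n k la (A : {ffun 'I_(head 0 la) -> {set 'I_n}})
    (B : {ffun 'I_(n - k) -> {set 'I_n}}) : in_OSP A B ->
  exists blk : 'I_n -> 'I_(head 0 la) + 'I_(n - k),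
    (forall p i, (blk p == inl i) = (p \in A i)) /\
    (forall p j, (blk p == inr j) = (p \in B j)).
Proof.
case/and3P=> /andP[uAB /and3P[/eqP covAB trivAB _]] _ _.
move: uAB; rewrite cat_uniq => /and3P[uA /hasPn ABdis uB].
pose Blk (t : 'I_(head 0 la) + 'I_(n - k)) := match t with inl i => A i | inr j => B j end.
have BlkP t : Blk t \in [set X in codom A ++ codom B].
  by rewrite inE mem_cat; case: t => i /=; rewrite codom_f ?orbT.
have Blk_inj : injective Blk.
  move=> [i|i] [j|j] /= ij.
  - by rewrite (injectiveP _ uA i j ij).
  - by have /negP[] := ABdis (B j) (codom_f B j); rewrite /= -ij codom_f.
  - by have /negP[] := ABdis (B i) (codom_f B i); rewrite /= ij codom_f.
  - by rewrite (injectiveP _ uB i j ij).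
have uniq_blk p t t' : p \in Blk t -> p \in Blk t' -> t = t'.
  move=> pt pt'; apply: Blk_inj; apply/eqP; apply: contraT => tt'.
  have := trivIsetP trivAB _ _ (BlkP t) (BlkP t') tt'.
  by rewrite -setI_eq0 => /eqP/setP/(_ p); rewrite !inE pt pt'.
have /fin_all_exists[blk blkP] : forall p, exists t, p \in Blk t.
  move=> p; have : p \in cover [set X in codom A ++ codom B] by rewrite covAB inE.
  case/bigcupP => X; rewrite inE mem_cat => /orP[/codomP[i ->]|/codomP[j ->]] pX.
    by exists (inl i).
  by exists (inr j).
have blkE p t : (blk p == t) = (p \in Blk t).
  by apply/eqP/idP => [<-//|pt]; apply: uniq_blk pt.
by exists blk; split=> p i; rewrite blkE.
Qed.

(** The positions outside the chains become the singletons. *)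
Lemma chains_Dnls n k la s L (h : 'I_L -> nat) x M (a : {ffun 'I_n -> nat}) (b : 'X_{1..n}) :
  k <= n -> is_part k la -> L = head 0 la -> (forall i : 'I_L, h i = conj_part la i.+1) ->
  (forall p, b p = a p) -> (forall p, a p < s) ->
  chains h 0 x M a -> Dnls k la s b.
Proof.
move=> kn lap LE hE ba as_ [A [disA cA _ lA _]]; subst L.
pose C := ~: \bigcup_i A i.
have cU : #|\bigcup_i A i| = k.
  rewrite -(sum_conj_part lap) -sum1_card (partition_disjoint_bigcup _ (fun => 1)).
    by apply: eq_bigr => i _; rewrite sum1_card cA hE.
  move=> i j ij; rewrite -setI_eq0; apply/eqP/setP => p; rewrite !inE.
  by apply: contraNF ij => /andP[pi pj]; apply/eqP; apply: disA pi pj.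
have cC : #|C| = n - k by rewrite cardsCs setCK card_ord cU.
pose B (j : 'I_(n - k)) : {set 'I_n} := [set enum_val (cast_ord (esym cC) j)].
have BC j p : p \in B j -> p \in C by rewrite inE => /eqP->; apply: enum_valP.
have disAC i p : p \in A i -> p \in C -> False.
  by move=> pA; rewrite inE => /negP[]; apply/bigcupP; exists i.
exists (finfun A), (finfun B); split.
- apply/and3P; split; last first.
  + by apply/forallP => j; rewrite ffunE cards1.
  + by apply/forallP => i; rewrite ffunE cA hE.
  have injA : injective A.
    move=> i j ij; have /card_gt0P[p pA] : 0 < #|A i| by rewrite cA hE (conj_part_gt0 (ltn_ord
      i)).
    by apply: (disA i j p) => //; rewrite -ij.
  have injB : injective B.
    by move=> i j /set1_inj/enum_val_inj/cast_ord_inj.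
  apply/andP; split.
    have uA : uniq (codom (finfun A)).
      by apply/injectiveP => i j; rewrite !ffunE => /injA.
    have uB : uniq (codom (finfun B)).
      by apply/injectiveP => i j; rewrite !ffunE => /injB.
    rewrite cat_uniq uA uB andbT /=.
    apply/hasPn => _ /mapP[j _ ->]; apply/negP => /mapP[i _]; rewrite !ffunE => AB.
    have pB : enum_val (cast_ord (esym cC) j) \in B j by rewrite inE.
    by apply: (disAC i _ _ (BC _ _ pB)); rewrite -AB.
  apply/and3P; split.
  + rewrite eqEsubset subsetT; apply/subsetP => p _; apply/bigcupP.
    case: (boolP (p \in C)) => [pC|].
      exists (B (cast_ord cC (enum_rank_in pC p))); last first.
        by rewrite inE cast_ordK enum_rankK_in.
      by rewrite inE mem_cat; apply/orP; right; apply/codomP; eexists; rewrite ffunE.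
    rewrite inE negbK => /bigcupP[i _ pA]; exists (A i) => //.
    by rewrite inE mem_cat; apply/orP; left; apply/codomP; exists i; rewrite ffunE.
  + apply/trivIsetP => X Y; rewrite !inE !mem_cat => XP YP XY.
    rewrite -setI_eq0; apply: contraNT XY => /set0Pn[p]; rewrite inE => /andP[].
    case/orP: XP => /codomP[i ->]; case/orP: YP => /codomP[j ->]; rewrite !ffunE => pX pY.
    * by rewrite (disA _ _ _ pX pY).
    * by case: (disAC _ _ pX (BC _ _ pY)).
    * by case: (disAC _ _ pY (BC _ _ pX)).
    * by move: pX pY; rewrite !inE => /eqP-> /eqP/enum_val_inj/cast_ord_inj->.
  + rewrite inE mem_cat; apply/norP; split; apply/negP => /codomP[i]; rewrite ffunE.
      move=> /esym/eqP; rewrite -cards_eq0 cA hE => /eqP h0.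
      by have := conj_part_gt0 (ltn_ord i); rewrite h0.
    by move=> /esym/eqP; rewrite -cards_eq0 cards1.
- by move=> i; apply: (@linked_descent_word _ a); rewrite ?ffunE //; apply: lA.
by move=> j l; rewrite mnmE ba.
Qed.

(** * Functionals on polynomials and block determinants *)

Import Order.TTheory GRing.Theory Num.Theory.
Local Open Scope ring_scope.

Section LinearExtension.
Variables (n : nat) (phi : 'X_{1..n} -> rat).
Implicit Types f g : {mpoly rat[n]}.

Definition linear_extension f := \sum_(m <- msupp f) f@_m * phi m.

Lemma linear_extension_wide f (D : seq 'X_{1..n}) :
  uniq D -> {subset msupp f <= D} ->
  linear_extension f = \sum_(m <- D) f@_m * phi m.
Proof.
move=> uD fD; rewrite (bigID (mem (msupp f))) /= [X in _ = _ + X]big1 ?addr0.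
  rewrite /linear_extension -[RHS]big_filter; apply: perm_big.
  apply: uniq_perm; rewrite ?filter_uniq ?msupp_uniq // => m.
  by rewrite mem_filter; case: (boolP (_ \in msupp f)) => // /fD ->.
by move=> m /memN_msupp_eq0->; rewrite mul0r.
Qed.

Lemma linear_extensionD f g :
  linear_extension (f + g) = linear_extension f + linear_extension g.
Proof.
pose D := undup (msupp f ++ msupp g); have uD : uniq D := undup_uniq _.
rewrite !(@linear_extension_wide _ D) //; first last.
- by move=> m /msuppD_le; rewrite mem_undup.
- by move=> m mf; rewrite mem_undup mem_cat mf.
- by move=> m mg; rewrite mem_undup mem_cat mg orbT.
by rewrite -big_split /=; apply: eq_bigr => m _; rewrite mcoeffD mulrDl.
Qed.

Lemma linear_extensionZ a f : linear_extension (a *: f) = a * linear_extension f.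
Proof.
rewrite (@linear_extension_wide _ (msupp f)) ?msupp_uniq //; last exact: msuppZ_le.
by rewrite mulr_sumr; apply: eq_bigr => m _; rewrite mcoeffZ mulrA.
Qed.

Lemma linear_extensionX m : linear_extension 'X_[m] = phi m.
Proof. by rewrite /linear_extension msuppX big_seq1 mcoeffX eqxx mul1r. Qed.

Lemma linear_extension_sum (I : Type) (r : seq I) (P : pred I) (F : I -> {mpoly rat[n]}) :
  linear_extension (\sum_(i <- r | P i) F i) = \sum_(i <- r | P i) linear_extension (F i).
Proof.
apply: (big_morph _ linear_extensionD).
by rewrite /linear_extension msupp0 big_nil.
Qed.
End LinearExtension.

Lemma sum_distinct n (A : {set 'I_n}) (f : 'I_n -> nat) : {in A &, injective f} ->
  (forall q, q \in A -> (f q < #|A|)%N) ->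
  (\sum_(q in A) f q = \sum_(0 <= i < #|A|) i)%N.
Proof.
move=> finj fA.
rewrite -big_enum /= -[LHS](big_map f xpredT id).
have uA : uniq [seq f q | q <- enum A].
  rewrite map_inj_in_uniq ?enum_uniq // => q r.
  by rewrite !mem_enum; apply: finj.
have sub : {subset [seq f q | q <- enum A] <= index_iota 0 #|A|}.
  by move=> x /mapP[q]; rewrite mem_enum mem_index_iota => /fA ? ->.
have [|_ eqA] := uniq_min_size uA sub; first by rewrite size_iota subn0 size_map -cardE.
by apply: perm_big; apply: uniq_perm; rewrite ?iota_uniq.
Qed.

Section BlockDeterminant.
Variables (n : nat) (T : finType) (blk : 'I_n -> T) (delta : 'I_n -> nat).
Implicit Types (e g c b : 'I_n -> nat) (S U : {set 'I_n}).
Hypothesis delta_inj : forall p q, blk p = blk q -> delta p = delta q -> p = q.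

(** The signed count of the permutations pi that preserve blocks and satisfy
    e = delta o pi. *)
Definition block_det e : rat :=
  \det (\matrix_(p, q) ((blk p == blk q) && (e p == delta q))%:R).

Lemma eq_block_det e g : e =1 g -> block_det e = block_det g.
Proof. by move=> eg; congr (\det _); apply/matrixP => p q; rewrite !mxE eg. Qed.

Lemma block_det_delta : block_det delta = 1.
Proof.
rewrite -[RHS](det1 _ n); congr (\det _); apply/matrixP => p q; rewrite !mxE.
case: (altP (p =P q)) => [->|pq]; first by rewrite !eqxx.
case: (blk p =P blk q) => //= pqb; case: (delta p =P delta q) => //.
by move=> /(delta_inj pqb)/eqP; rewrite (negbTE pq).
Qed.

Lemma block_det_support e : block_det e != 0 ->
  exists pi : 'S_n, forall p, blk (pi p) = blk p /\ e p = delta (pi p).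
Proof.
move=> ne0; have [pi /forallP piP|none] :=
  pickP (fun pi : 'S_n => [forall p, (blk (pi p) == blk p) && (e p == delta (pi p))]).
  by exists pi => p; have /andP[/eqP-> /eqP->] := piP p.
case/eqP: ne0; rewrite /block_det /determinant big1 // => pi _.
have /forallPn[p pP] := negbT (none pi).
by rewrite (bigD1 p) //= mxE [blk p == _]eq_sym (negbTE pP) mul0r mulr0.
Qed.

Lemma block_det_swap e p q : p != q -> blk p = blk q ->
  block_det (fun x => e (tperm p q x)) = - block_det e.
Proof.
move=> pq pqb.
have blkt x : blk (tperm p q x) = blk x by case: tpermP => // ->.
rewrite -mulN1r -[-1]expr1.
have -> : 1%N = odd_perm (tperm p q) by rewrite odd_tperm pq.
rewrite -det_perm -det_mulmx -row_permE; congr (\det _).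
by apply/matrixP => x y; rewrite !mxE blkt.
Qed.

(** If g takes the same value at two places of a block, both in S, the swap of
    these places is a sign-reversing bijection of the summands. Otherwise g is
    injective on each block of K contained in S. If a summand is nonzero then
    both g and g + 1_U are bijections from such a block to the same interval, so
    U avoids the block. Then U is too small. *)
Lemma block_det_esym (K : pred T) g S d :
  (forall p, K (blk p) -> (delta p < #|[set q | blk q == blk p]|)%N) ->
  (#|S| < d + #|[set p in S | K (blk p) && ([set q | blk q == blk p] \subset S)]|)%N ->
  \sum_(U : {set 'I_n} | (U \subset S) && (#|U| == d))
     block_det (fun p => g p + (p \in U))%N = 0.
Proof.
set F := [set p in S | _] => Kdelta Sd.
have [p /existsP[q /and5P[pS qS pq /eqP pqb /eqP gpq]]|inj] :=
  pickP (fun p => [exists q, [&& p \in S, q \in S, p != q, blk p == blk q & g p == g q]]).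
  set t := tperm p q; set s := \sum_(U | _) _.
  have tS U : U \subset S -> t @: U \subset S.
    move=> /subsetP US; apply/subsetP => _ /imsetP[x /US xS ->].
    by rewrite /t; case: tpermP.
  have tK : involutive (fun U : {set 'I_n} => t @: U).
    move=> U; rewrite -imset_comp; apply/setP => x.
    rewrite (eq_imset (g := id)) ?imset_id // => y /=; exact: tpermK.
  suff: s = - s.
    by move=> ss; apply/eqP; rewrite -eqNr -ss.
  rewrite {1}/s (reindex_inj (inv_inj tK)) -sumrN; apply: eq_big => [U|U _].
    rewrite card_imset; last exact: perm_inj.
    congr (_ && _); apply/idP/idP => [/tS|/tS//]; by rewrite tK.
  rewrite -(block_det_swap _ pq pqb); apply: eq_block_det => x.
  rewrite -/t; congr (_ + _)%N; last first.
    by rewrite -{1}[x](tpermK p q) mem_imset //; apply: perm_inj.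
  by rewrite /t; case: tpermP => // ->.
apply: big1 => U /andP[US /eqP cU]; apply/eqP; apply: contraT => /block_det_support[pi piP].
have {}inj p q : p \in S -> q \in S -> blk p = blk q -> g p = g q -> p = q.
  move=> pS qS pqb gpq; apply/eqP; apply: contraT => pq.
  by have /existsP[] := negbT (inj p); exists q; rewrite pS qS pq pqb gpq !eqxx.
suff UF : U \subset S :\: F.
  have := subset_leq_card UF; rewrite cU cardsD.
  have FS : F \subset S by apply/subsetP => p; rewrite inE => /andP[].
  rewrite (setIidPr FS); move: Sd (subset_leq_card FS); clear; lia.
apply/subsetP => p pU; rewrite inE (subsetP US) // andbT.
apply/negP; rewrite inE => /and3P[pS Kp /subsetP].
set A := [set q | _] => AS.
have Ap q : (q \in A) = (blk q == blk p) by rewrite inE.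
have Adelta q : q \in A -> (delta q < #|A|)%N.
  by rewrite Ap => /eqP qp; rewrite /A -qp Kdelta // qp.
have piA q : q \in A -> pi q \in A by rewrite !Ap (piP q).1.
(* g and g + 1_U have the same sum over A, both being onto the interval. *)
pose e q := (g q + (q \in U))%N.
have eA : (\sum_(q in A) e q = \sum_(q in A) g q)%N.
  rewrite !sum_distinct // => q.
  - by move=> r qA rA; apply: inj; rewrite ?AS //; move: qA rA; rewrite !Ap => /eqP-> /eqP->.
  - by move=> qA; apply: leq_ltn_trans (Adelta _ (piA q qA)); rewrite -(piP q).2 leq_addr.
  - move=> r qA rA; rewrite /e (piP q).2 (piP r).2 => /delta_inj eqr.
    by apply/(@perm_inj _ pi)/eqr; move: (piA q qA) (piA r rA); rewrite !Ap => /eqP-> /eqP->.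
  - by move=> qA; rewrite /e (piP q).2; apply/Adelta/piA.
have : (\sum_(q in A) (q \in U) = 0)%N.
  by move: eA; rewrite big_split /=; lia.
by move/eqP; rewrite sum_nat_eq0 => /forall_inP/(_ p); rewrite Ap eqxx pU => /(_ isT).
Qed.
End BlockDeterminant.

(** * Linear independence *)

Section Rearrangement.
Variables (n : nat) (T : finType) (blk : 'I_n -> T) (delta y : 'I_n -> nat).
Hypothesis delta_inj : forall p q, blk p = blk q -> delta p = delta q -> p = q.
Hypothesis comonotone :
  forall p q, blk p = blk q -> (delta q < delta p)%N -> (y q < y p)%N.

Let pairing (pi : 'S_n) := (\sum_p delta (pi p) * y p)%N.

(** Let p be a moved point with delta p maximal. Redirecting to p its own value
    delta p is an exchange that increases the sum. *)
Lemma pairing_improve (pi : 'S_n) : (forall p, blk (pi p) = blk p) -> pi != 1%g ->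
  exists2 rho : 'S_n, forall p, blk (rho p) = blk p & (pairing pi < pairing rho)%N.
Proof.
move=> blkpi pi1.
have [p0 p0pi] : exists p, pi p != p.
  apply/existsP; apply: contraR pi1; rewrite negb_exists => /forallP fix_pi.
  by apply/eqP/permP => p; rewrite perm1; apply/eqP; rewrite -[_ == _]negbK.
have P0 : [pred p | pi p != p] p0 by [].
case: (@arg_maxnP _ p0 [pred p | pi p != p] delta P0) => p /= pip pmax.
set q := (pi^-1)%g p; set r := pi p.
have piq : pi q = p by rewrite permKV.
have qp : q != p by apply: contraNneq pip => qp; rewrite -{2}piq qp.
have blkq : blk q = blk p by rewrite -piq blkpi.
have blkr : blk r = blk p by rewrite blkpi.
have below x : blk x = blk p -> x != p -> pi x != x -> (delta x < delta p)%N.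
  move=> xb xp xm; rewrite ltn_neqAle pmax // andbT.
  by apply: contra_neq xp; apply: delta_inj.
have dr : (delta r < delta p)%N by apply: below => //; rewrite (inj_eq perm_inj).
have dq : (delta q < delta p)%N by apply: below; rewrite // piq eq_sym.
have yq := comonotone (esym blkq) dq.
(* The product applies tperm p q first: p is now fixed, and q goes to pi p. *)
exists (tperm p q * pi)%g.
  by move=> x; rewrite permM blkpi; case: tpermP => // ->.
rewrite /pairing (bigD1 p) //= (bigD1 q) //= [X in (_ < X)%N](bigD1 p) //=.
rewrite [X in (_ < _ + X)%N](bigD1 q) //= !permM tpermL tpermR piq -/r.
rewrite (eq_bigr (fun x => delta ((tperm p q * pi)%g x) * y x)%N).
  rewrite !addnA ltn_add2r; move: yq dr; clear; nia.
by move=> x /andP[xp xq]; rewrite permM tpermD // eq_sym.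
Qed.

Lemma rearrangement (pi : 'S_n) : (forall p, blk (pi p) = blk p) -> pi != 1%g ->
  (\sum_p delta (pi p) * y p < \sum_p delta p * y p)%N.
Proof.
move=> blkpi pi1; have [rho blkrho lt_rho] :=
  pairing_improve blkpi pi1.
have P1 : [pred rho : 'S_n | [forall p, blk (rho p) == blk p]] rho.
  by apply/forallP => p; rewrite blkrho.
case: (@arg_maxnP _ rho _ pairing P1) => tau /forallP blktau taumax.
have -> : (\sum_p delta p * y p = pairing tau)%N.
  case: (altP (tau =P 1%g)) => [->|tau1].
    by apply: eq_bigr => p _; rewrite perm1.
  have [p|rho' blkrho' lt] := pairing_improve _ tau1; first by apply/eqP.
  have /taumax : [pred rho : 'S_n | [forall p, blk (rho p) == blk p]] rho'.
    by apply/forallP => p; rewrite blkrho'.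
  by rewrite /= leqNgt lt.
exact: leq_trans lt_rho (taumax _ P1).
Qed.
End Rearrangement.

Section Score.
Variable n : nat.

(** Strictly convex in b, with a shift by the position that breaks ties. *)
Definition score (b : 'X_{1..n}) : int := \sum_p ((n * b p)%:Z - p%:Z) ^+ 2.

(** Here b + c = delta and b' + c = delta o pi. The scores of b and b' differ only
    in the pairing of delta o pi with n * c_p + p, which enters with a minus
    sign and is the largest for pi = 1. *)
Lemma score_lt (T : finType) (blk : 'I_n -> T) (delta c : 'I_n -> nat)
    (b b' : 'X_{1..n}) (pi : 'S_n) :
  (forall p q, blk p = blk q -> delta p = delta q -> p = q) ->
  (forall p q, blk p = blk q -> (delta q < delta p)%N ->
     (n * c q + q < n * c p + p)%N) ->
  (forall p, b p + c p = delta p)%N ->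
  (forall p, blk (pi p) = blk p /\ (b' p + c p)%N = delta (pi p)) ->
  b' != b -> score b < score b'.
Proof.
move=> dinj como bE b'E bb'.
have pi1 : pi != 1%g.
  apply: contraNneq bb' => pi1; apply/eqP/mnmP => p.
  by have := (b'E p).2; rewrite pi1 perm1 -bE => /addIn.
have n0 : (0 < n)%N.
  rewrite lt0n; apply: contra pi1 => /eqP n0; apply/eqP/permP => p.
  by have := ltn_ord p; rewrite [X in (_ < X)%N]n0.
have lt := rearrangement dinj como (fun p => (b'E p).1) pi1.
(* n * b_p - p = n * delta_(pi p) - y_p, and only the cross term of the square
   depends on pi after summation. *)
pose y p := ((n * c p + p)%N)%:Z; pose d p := (delta p)%:Z.
have sE (b0 : 'X_{1..n}) (rho : 'S_n) : (forall p, b0 p + c p = delta (rho p))%N ->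
  score b0 = (\sum_p (n%:Z * d p) ^+ 2 + \sum_p y p ^+ 2)
    - 2%:Z * n%:Z * \sum_p d (rho p) * y p.
  move=> b0E; rewrite [X in X + _ - _](reindex_inj (@perm_inj _ rho)) /=.
  rewrite mulr_sumr -sumrN -!big_split /=; apply: eq_bigr => p _.
  rewrite /d /y -b0E !PoszD !PoszM; ring.
rewrite (sE b 1%g) => [|p]; last by rewrite perm1.
rewrite (sE b' pi) => [|p]; last by have [] := b'E p.
rewrite ltrD2l ltrN2 ltr_pM2l ?mulr_gt0 ?ltr0n ?ltz_nat //.
have toZ (rho : 'S_n) : \sum_p d (rho p) * y p = ((\sum_p delta (rho p) * (n * c p + p))%N)%:Z.
  by rewrite (big_morph Posz PoszD (erefl _)); apply: eq_bigr => p _; rewrite PoszM.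
rewrite !toZ ltz_nat; apply: leq_trans lt _.
by under [X in (_ <= X)%N]eq_bigr do rewrite perm1.
Qed.
End Score.

(** A functional phi_b that vanishes on the ideal, has value 1 at b and can be
    nonzero elsewhere only at larger scores isolates the coefficient of b when
    the score of b is maximal in a relation. *)
Lemma triangular_independence n (G : {mpoly rat[n]} -> Prop) (D : 'X_{1..n} -> Prop) :
  (forall b, D b -> exists phi : 'X_{1..n} -> rat,
     [/\ phi b = 1, forall b', phi b' != 0 -> b' != b -> score b < score b' &
         forall m g, G g -> linear_extension phi ('X_[m] * g) = 0]) ->
  forall (r : seq 'X_{1..n}) (c : 'X_{1..n} -> rat),
    uniq r -> (forall b, b \in r -> D b) ->
    \sum_(b <- r) c b *: 'X_[b] \in ideal_gen G ->
    forall b, b \in r -> c b = 0.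
Proof.
move=> phiP r c ur rD /boolp.asboolP[s sG sE] b0 b0r; apply/eqP; apply: contraT => cb0.
have [b [br cb bmax]] : exists b, [/\ b \in r, c b != 0 &
    forall b', b' \in r -> c b' != 0 -> score b' <= score b].
  elim: r b0 b0r {ur rD sE} cb0 => // x r IH b0.
  rewrite inE => b0r cb0.
  have [/hasP[x' x'r cx']|/hasPn none] := boolP (has (fun b => c b != 0) r).
    have [b [br cb bmax]] := IH x' x'r cx'.
    case: (boolP ((c x != 0) && (score b < score x))) => [/andP[cx lt]|nx].
      exists x; rewrite mem_head cx; split=> // b'; rewrite inE => /predU1P[->//|b'r] cb'.
      exact: le_trans (bmax _ b'r cb') (ltW lt).
    exists b; rewrite inE br orbT; split=> // b'; rewrite inE => /predU1P[->|];
      last exact: bmax.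
    by move=> cx; move: nx; rewrite cx /= -leNgt.
  have xr : b0 = x by case/predU1P: b0r => // /none; rewrite cb0.
  exists x; rewrite mem_head -{1}xr; split=> // b'; rewrite inE => /predU1P[->//|/none/negP].
  by [].
have [phi [phib tri kill]] := phiP b (rD b br).
have : linear_extension phi (\sum_(b <- r) c b *: 'X_[b]) = 0.
  rewrite sE linear_extension_sum big_seq big1 // => -[a g] /sG /= Gg.
  rewrite (mpolyE a) mulr_suml linear_extension_sum big1 // => m _.
  by rewrite -scalerAl linear_extensionZ kill ?mulr0.
rewrite linear_extension_sum (bigD1_seq b) //= linear_extensionZ linear_extensionX phib mulr1.
rewrite big_seq_cond big1 ?addr0 => [/eqP|b' /andP[b'r b'b]]; first by rewrite (negbTE cb).
rewrite linear_extensionZ linear_extensionX; apply/eqP; rewrite mulf_eq0.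
case: eqP => //= /eqP cb'; apply/negPn/negP => /tri/(_ b'b).
by rewrite ltNge bmax.
Qed.

(** The value at x^e is the block determinant of e + c, where b + c = delta. On
    the blocks A_i the values delta come from [descent_block], and on singletons
    delta = b. All of delta is below s, so the powers X_i^s are killed. *)
Lemma Dnls_functional n k s la b :
  (k <= n)%N -> is_part k la -> (size la <= s)%N -> Dnls k la s b ->
  exists phi : 'X_{1..n} -> rat,
     [/\ phi b = 1, forall b', phi b' != 0 -> b' != b -> score b < score b' &
         forall m g, I_gen la s g -> linear_extension phi ('X_[m] * g) = 0].
Proof.
move=> kn lap sla [A [B [AB desc small]]].
have [blk [blkA blkB]] := osp_blocks AB.
case/and3P: AB => _ /forallP cA /forallP cB.
(* K selects the blocks A_i. *)
pose K (t : 'I_(head 0%N la) + 'I_(n - k)) := if t is inl _ then true else false.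
have /fin_all_exists[del delP] : forall t, exists delta : 'I_n -> nat,
  [/\ forall p, blk p = t -> (b p <= delta p < s)%N,
      forall p, blk p = t -> K t -> (delta p < #|[set q | blk q == t]|)%N,
      forall p q, blk p = t -> blk q = t -> delta p = delta q -> p = q &
      forall p q, blk p = t -> blk q = t -> (delta q < delta p)%N ->
        (n * (delta q - b q) + q < n * (delta p - b p) + p)%N].
  case=> [i|j].
    have [delta [d1 d2 d3]] := descent_block (desc i).
    have eqA : [set q | blk q == inl i] = A i by apply/setP => q; rewrite inE blkA.
    have inA p : blk p = inl i -> p \in A i by move/eqP; rewrite blkA.
    exists delta; split=> [p /inA pA|p /inA pA _|p q /inA pA /inA qA|p q /inA pA /inA qA].
    - have /andP[-> /= dA] := d1 p pA; apply: leq_trans dA (leq_trans _ sla).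
      by rewrite (eqP (cA i)); apply: count_size.
    - by rewrite eqA; case/andP: (d1 p pA).
    - exact: d2.
    - exact: d3.
  have single p q : blk p = inr j -> blk q = inr j -> p = q.
    by move=> /eqP + /eqP; rewrite !blkB; have /cards1P[x ->] := cB j;
      rewrite !inE => /eqP-> /eqP->.
  exists b; split=> // [p|p q pj qj _|p q pj qj].
  - move/eqP; rewrite leqnn blkB => pB.
    by have := small j (enum_rank_in pB p); rewrite mnmE enum_rankK_in.
  - exact: single.
  - by rewrite (single _ _ pj qj) ltnn.
pose delta p := del (blk p) p; pose c p := (delta p - b p)%N.
have bdelta p : (b p <= delta p < s)%N by have [+ _ _ _] := delP (blk p); apply.
have bc p : (b p + c p = delta p)%N by rewrite subnKC //; case/andP: (bdelta p).
have dinj p q : blk p = blk q -> delta p = delta q -> p = q.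
  by rewrite /delta => pq; rewrite pq; have [_ _ + _] := delP (blk q); apply.
have como p q : blk p = blk q -> (delta q < delta p)%N ->
     (n * c q + q < n * c p + p)%N.
  by rewrite /c /delta => pq; rewrite pq; have [_ _ _] := delP (blk q); apply.
exists (fun b' => block_det blk delta (fun p => b' p + c p)%N); split.
- by rewrite (eq_block_det _ _ bc) block_det_delta.
- move=> b' /block_det_support[pi piP] ne.
  exact: (score_lt dinj como bc piP ne).
move=> m g [[i ->]|[S [d [Sd ->]]]].
  rewrite mpolyXn -mpolyXD linear_extensionX.
  apply/eqP; apply: contraT => /block_det_support[pi /(_ i)[_ piE]].
  case/andP: (bdelta (pi i)) => _; rewrite -piE mnmDE mulmnE mnm1E eqxx mul1n.
  by rewrite ltnNge -addnA addnCA leq_addr.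
rewrite /esym_on mulr_sumr linear_extension_sum.
under eq_bigr => U _.
  rewrite mprodXE -mpolyXD linear_extensionX.
  rewrite (_ : block_det _ _ _ = block_det blk delta (fun p => (m p + c p) + (p \in U))%N).
    over.
  apply: eq_block_det => p; rewrite mnmDE mnm_sumE addnAC; congr (_ + _ + _)%N.
  case: (boolP (p \in U)) => pU; last first.
    by rewrite big1 // => i iU; rewrite mnm1E; case: eqP => // ip; rewrite -ip iU in pU.
  rewrite (bigD1 p) //= mnm1E eqxx big1 ?addn0 // => i /andP[_ /negbTE ip].
  by rewrite mnm1E ip.
apply: (@block_det_esym _ _ _ _ dinj K).
  by move=> p; rewrite /delta; have [_ + _ _] := delP (blk p); apply.
apply: leq_trans Sd _; rewrite leq_add2l.
(* A block outside Q meets the complement of S, which has n - |S| elements. *)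
pose Q (i : 'I_(head 0%N la)) := A i \subset S.
apply: (@leq_trans (\sum_(i | Q i) conj_part la i.+1)).
  apply: (conj_part_counting n lap sla).
  have -> : (n - #|S| = #|~: S|)%N by rewrite [RHS]cardsCs setCK card_ord.
  rewrite -(card_imset [predC Q] (@inl_inj _ 'I_(n - k))).
  apply: (@leq_trans #|blk @: ~: S|); last exact: leq_imset_card.
  apply: subset_leq_card.
  apply/subsetP => _ /imsetP[i + ->]; rewrite !inE => /subsetPn[p pA pS].
  by apply/imsetP; exists p; rewrite ?inE //; apply/esym/eqP; rewrite blkA.
pose A' i := if Q i then A i else set0.
have -> : (\sum_(i | Q i) conj_part la i.+1 = \sum_i \sum_(p in A' i) 1)%N.
  rewrite big_mkcond; apply: eq_bigr => i _; rewrite sum1_card /A' -(eqP (cA i)).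
  by case: (Q i); rewrite ?cards0.
have inA' p i : p \in A' i -> A i \subset S /\ blk p = inl i.
  by rewrite /A'; case: ifP => [QAi|_]; rewrite ?inE // -blkA => /eqP.
rewrite -(partition_disjoint_bigcup _ (fun=> 1%N)) /= ?sum1_card.
  apply: subset_leq_card; apply/bigcupsP => i _; apply/subsetP => p /inA'[AiS bp].
  have pA : p \in A i by rewrite -blkA bp.
  rewrite inE (subsetP AiS) // bp /=; apply/subsetP => q.
  by rewrite inE blkA; apply: (subsetP AiS).
move=> i j; apply: contraNT; rewrite -setI_eq0 => /set0Pn[p].
by rewrite inE => /andP[/inA'[_ bi] /inA'[_]]; rewrite bi => -[->].
Qed.

Lemma Dnls_independent n k s la (r : seq 'X_{1..n}) (c : 'X_{1..n} -> rat) :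
  (k <= n)%N -> is_part k la -> (size la <= s)%N ->
  uniq r -> (forall b, b \in r -> Dnls k la s b) ->
  \sum_(b <- r) c b *: 'X_[b] \in ideal_gen (I_gen la s) ->
  forall b, b \in r -> c b = 0.
Proof.
move=> kn lap sla; apply: triangular_independence => b; exact: Dnls_functional.
Qed.

(** * Spanning *)

Section IdealMembership.
Variable n : nat.
Local Notation P := {mpoly rat[n]}.
Implicit Types (G H : P -> Prop) (f g x : P).

Lemma ideal_gen_gen G g : G g -> g \in ideal_gen G.
Proof.
move=> Gg; apply/boolp.asboolP; exists [:: (1, g)]; last by rewrite big_seq1 mul1r.
by move=> ag; rewrite inE => /eqP->.
Qed.

Lemma ideal_gen_mul_sub G H x : (forall g, G g -> x * g \in ideal_gen H) ->
  forall f, f \in ideal_gen G -> x * f \in ideal_gen H.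
Proof.
move=> GH f /boolp.asboolP[c cG ->]; rewrite mulr_sumr big_seq.
apply: rpred_sum => -[a g] /cG /= /GH Hg.
by rewrite mulrCA; apply: ideal_genM.
Qed.

Lemma ideal_gen_sub G H : (forall g, G g -> H g) ->
  forall f, f \in ideal_gen G -> f \in ideal_gen H.
Proof.
move=> GH f fG; rewrite -[f]mul1r; apply: ideal_gen_mul_sub fG => g /GH Hg.
by rewrite mul1r ideal_gen_gen.
Qed.

Lemma ideal_gen_adjoin G x f : f \in ideal_gen (fun g => G g \/ g = x) ->
  exists h, f - h * x \in ideal_gen G.
Proof.
case/boolp.asboolP=> c cG ->; elim: c cG => [|[a g] c IH] cG.
  by exists 0; rewrite big_nil mul0r subr0 rpred0.
have [h hP] := IH (fun ag agc => cG ag (mem_behead (agc : ag \in behead ((a, g) :: c)))).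
rewrite big_cons /=; case: (cG (a, g) (mem_head _ _)) => /= [Gg|->].
  by exists h; rewrite -addrA rpredD //; apply/ideal_genM/ideal_gen_gen.
exists (h + a); set t := \sum_(_ <- _) _ in hP *.
by have -> : a * x + t - (h + a) * x = t - h * x by ring.
Qed.
End IdealMembership.

Section SpanModulo.
Variable n : nat.
Local Notation P := {mpoly rat[n]}.
Implicit Types (Y : seq P) (G : P -> Prop) (f : P).

(** Coefficients are kept as a list of pairs so that sums are concatenations. *)
Definition spanned Y G f := exists2 c : seq (rat * P),
  (forall ay, ay \in c -> ay.2 \in Y) & f - \sum_(ay <- c) ay.1 *: ay.2 \in ideal_gen G.

Lemma spannedD Y G f g : spanned Y G f -> spanned Y G g -> spanned Y G (f + g).
Proof.
move=> [c cY fc] [d dY gd]; exists (c ++ d) => [ay|].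
  by rewrite mem_cat => /orP[/cY|/dY].
by rewrite big_cat opprD addrACA rpredD.
Qed.

Lemma spannedZ Y G a f : spanned Y G f -> spanned Y G (a *: f).
Proof.
move=> [c cY fc]; exists [seq (a * ay.1, ay.2) | ay <- c].
  by move=> _ /mapP[ay /cY ? ->].
rewrite big_map /=; under eq_bigr do rewrite -scalerA.
by rewrite -scaler_sumr -scalerBr -mulr_algl ideal_genM.
Qed.

Lemma spanned_ideal Y G f : f \in ideal_gen G -> spanned Y G f.
Proof. by move=> fG; exists [::]; rewrite ?big_nil ?subr0. Qed.

Lemma spanned_mem Y G f : f \in Y -> spanned Y G f.
Proof.
move=> fY; exists [:: (1, f)]; last by rewrite big_seq1 scale1r subrr rpred0.
by move=> ay; rewrite inE => /eqP->.
Qed.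

Lemma spanned_sum Y G (I : eqType) (r : seq I) (F : I -> P) :
  (forall i, i \in r -> spanned Y G (F i)) -> spanned Y G (\sum_(i <- r) F i).
Proof.
elim: r => [|i r IH] FY; first by rewrite big_nil; apply/spanned_ideal/rpred0.
rewrite big_cons; apply: spannedD; first by apply: FY; rewrite mem_head.
by apply: IH => j jr; apply: FY; rewrite inE jr orbT.
Qed.
End SpanModulo.

Section Spanning.
Variables (n s : nat).
Local Notation P := {mpoly rat[n]}.
Implicit Types (V S : {set 'I_n}) (m : 'I_s -> nat) (p : 'I_n) (r : 'I_s) (f : P).

(** For m r = la_r this is the sum of the parts of the transpose beyond the
    first c. *)
Definition excess m (c : nat) := (\sum_r (m r - c))%N.

(** Generators of the ideal I(V, m), the analogue of the ideal of the theorem for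
    the variables in V; the others are sent to 0. *)
Definition tanisaki V m (g : P) :=
  [\/ exists j, g = 'X_j ^+ s, exists2 j, j \notin V & g = 'X_j |
      exists S d, [/\ S \subset V, (#|S| < d + excess m (#|V| - #|S|))%N & g = esym_on S d]].

Definition decrement m r r' := (m r' - (r' == r))%N.

Lemma excessS m c : excess m c = (excess m c.+1 + #|[set r | c < m r]|)%N.
Proof.
rewrite -sum1_card [in RHS]big_mkcond -big_split /=; apply: eq_bigr => r _.
by rewrite inE; case: ltnP; lia.
Qed.

Lemma excess_decrement m r c :
  excess m c = (excess (decrement m r) c + (c < m r))%N.
Proof.
rewrite /excess (bigD1 r) //= [in RHS](bigD1 r) //= addnAC; congr (_ + _)%N.
  by rewrite /decrement eqxx; case: ltnP; lia.
by apply: eq_bigr => r' /negbTE ne; rewrite /decrement ne subn0.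
Qed.

Lemma esym_on0 S : esym_on S 0 = 1.
Proof.
rewrite /esym_on (bigD1 set0) /= ?sub0set ?cards0 // big_set0 big1 ?addr0 // => T.
by rewrite cards_eq0 => /andP[/andP[_ ->]].
Qed.

Lemma esym_onU1 S p d : p \notin S ->
  esym_on (p |: S) d.+1 = esym_on S d.+1 + 'X_p * esym_on S d.
Proof.
move=> pS; rewrite /esym_on (bigID (fun T : {set 'I_n} => p \in T)) /= addrC; congr (_ + _).
  by apply: eq_bigl => T; rewrite andbAC -subsetD1 setU1K.
rewrite mulr_sumr (reindex_onto (fun T => p |: T) (fun T => T :\ p)) /=; last first.
  by move=> T /andP[_ pT]; rewrite setD1K.
apply: eq_big => [T|T /andP[_ /eqP TE]]; last first.
  by rewrite big_setU1 // -TE !inE eqxx.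
rewrite setU11 andbT -{2}[S](setU1K pS) subsetD1.
case: (boolP (p \in T)) => pT; rewrite ?andbF ?andbT.
  apply/negbTE/nandP; right; apply/eqP => /setP/(_ p).
  by rewrite !inE eqxx pT.
by rewrite setU1K // eqxx andbT cardsU1 pT add1n eqSS subUset sub1set setU11.
Qed.

(** Let c = #|V - p| - #|S| for a generator e_d(S) on the left. If c < m r, the
    missing p lowers the bound by one and e_d(S) is e_d(S + p) modulo X_p. If
    m r <= c, an induction on the exponent j of X_p uses the identity
    X_p e_d(S) = e_{d+1}(S + p) - e_{d+1}(S): the loss in the bound for e_d(S) in
    passing from V - p to V is the number of letters with m > c, all of which
    come before r, and multiplying by X_p makes it up one by one. *)
Lemma tanisaki_step V m p r f : p \in V ->
  f \in ideal_gen (tanisaki (V :\ p) (decrement m r)) ->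
  'X_p ^+ ranking m r * f \in
    ideal_gen (fun g => tanisaki V m g \/ g = 'X_p ^+ (ranking m r).+1).
Proof.
move=> pV; set J := fun g => _ \/ _; apply: ideal_gen_mul_sub => g.
have inJ h : tanisaki V m h -> h \in ideal_gen J by move=> hV; apply: ideal_gen_gen; left.
have XJ h : 'X_p ^+ ranking m r * ('X_p * h) \in ideal_gen J.
  by rewrite mulrA -exprSr mulrC; apply: ideal_genM; apply: ideal_gen_gen; by right.
case=> [[j ->]|[j jV ->]|[S [d [SV Sd ->]]]].
- by apply/ideal_genM/inJ; constructor 1; exists j.
- case: (altP (j =P p)) => [->|jp]; first by rewrite -[X in _ * X]mulr1 XJ.
  apply/ideal_genM/inJ; constructor 2; exists j => //.
  by move: jV; rewrite !inE jp.
have pS : p \notin S by apply/negP => /(subsetP SV); rewrite !inE eqxx.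
have SV' : S \subset V := subset_trans SV (subsetDl _ _).
have pSV : p |: S \subset V by rewrite subUset sub1set pV.
have cV : #|V| = #|V :\ p|.+1 by rewrite (cardsD1 p) pV.
have cS := subset_leq_card SV.
have cpS : #|p |: S| = #|S|.+1 by rewrite cardsU1 pS.
set c := (#|V :\ p| - #|S|)%N in Sd.
have cE : (#|V| - #|p |: S| = c)%N by rewrite cV cpS subSS.
have cSE : (#|V| - #|S| = c.+1)%N by rewrite cV subSn.
have big_in e : (#|S|.+1 < e + excess m c)%N -> esym_on (p |: S) e \in ideal_gen J.
  by move=> lt; apply: inJ; constructor 3; exists (p |: S), e; rewrite cE cpS.
have small_in e : (#|S| < e + excess m c.+1)%N -> esym_on S e \in ideal_gen J.
  by move=> lt; apply: inJ; constructor 3; exists S, e; rewrite cSE.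
have exE := excess_decrement m r c.
case: (ltnP c (m r)) exE => [cr|rc]; rewrite ?addn0 ?addn1 => exE.
  case: d Sd => [|d] Sd.
    by rewrite esym_on0 -(esym_on0 (p |: S)); apply/ideal_genM/big_in; rewrite exE; lia.
  have -> : esym_on S d.+1 = esym_on (p |: S) d.+1 - 'X_p * esym_on S d.
    by rewrite esym_onU1 // addrK.
  by rewrite mulrBr rpredB //; first (apply/ideal_genM/big_in; rewrite exE; lia); apply: XJ.
rewrite -exE in Sd.
have Sd' : (#|S| < d + ranking m r + excess m c.+1)%N.
  apply: leq_trans Sd _; rewrite excessS -addnA leq_add2l addnC leq_add2r.
  apply/subset_leq_card/subsetP => r'; rewrite !inE /before => cr'.
  by rewrite (leq_ltn_trans rc cr').
elim: (ranking m r) d Sd Sd' {XJ} => [|j IH] d Sd Sd'.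
  by rewrite expr0 mul1r small_in // -(addn0 d).
rewrite exprSr -mulrA.
have -> : 'X_p * esym_on S d = esym_on (p |: S) d.+1 - esym_on S d.+1.
  by rewrite esym_onU1 // addrC addKr.
rewrite mulrBr rpredB ?IH //.
- by apply/ideal_genM/big_in; rewrite addSn ltnS.
- by rewrite addSn ltnW.
- by rewrite addSnnS.
Qed.

Fixpoint spanning_list (ps : seq 'I_n) m : seq P :=
  if ps is p :: ps' then
    [seq 'X_p ^+ ranking m r * y | r <- enum 'I_s, y <- spanning_list ps' (decrement m r)]
  else if [forall r, m r == 0%N] then [:: 1] else [::].

(** By descending induction on i, every multiple of X_p^i is spanned: X_p^s is in
    the ideal, and for the letter of rank i [tanisaki_step] reduces X_p^i f to
    the span and to multiples of X_p^(i+1). *)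
Lemma spanning_list_spans ps m f : uniq ps ->
  spanned (spanning_list ps m) (tanisaki [set p in ps] m) f.
Proof.
elim: ps m f => [|p ps IH] m f /=.
  move=> _; case: ifPn => [/forallP m0|/forallPn[r mr]]; last first.
    apply: spanned_ideal; rewrite -[f]mulr1; apply/ideal_genM/ideal_gen_gen.
    constructor 3; exists set0, 0%N; rewrite sub0set cards0 esym_on0; split=> //.
    by rewrite add0n /excess (bigD1 r) //= !subn0 addn_gt0 lt0n mr.
  rewrite (mpolyE f); apply: spanned_sum => b _; apply: spannedZ.
  case: (altP (b =P 0%MM)) => [->|b0]; first by rewrite mpolyX0; apply: spanned_mem;
    rewrite inE.
  apply: spanned_ideal; have [j bj] : exists j, b j != 0%N.
    apply/existsP; apply: contraR b0; rewrite negb_exists => /forallP b0.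
    by apply/eqP/mnmP => j; rewrite mnm0E; apply/eqP; rewrite -[_ == _]negbK.
  have -> : b = (b - U_(j) + U_(j))%MM.
    by rewrite submK // lep1mP.
  rewrite mpolyXD; apply/ideal_genM/ideal_gen_gen; constructor 2; exists j => //.
  by rewrite !inE.
move=> /andP[pps ups]; set V := [set q in p :: ps]; set Y := (X in spanned X _ _).
have Vp : V :\ p = [set q in ps].
  apply/setP => q; rewrite !inE; case: eqP => //= ->; exact/esym/negbTE.
have pV : p \in V by rewrite !inE eqxx.
suff H i h : spanned Y (tanisaki V m) ('X_p ^+ i * h) by rewrite -[f]mul1r; apply: (H 0%N).
have [d dE] := ubnP (s - i); elim: d i h dE => // d IHd i h dE.
case: (ltnP i s) => is_; last first.
  apply: spanned_ideal; rewrite -(subnK is_) exprD mulrAC; apply/ideal_genM/ideal_gen_gen.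
  by constructor 1; exists p.
have [sigma sigmaK] := ranking_perm m.
pose r := sigma (Ordinal is_); have ri : ranking m r = i by rewrite sigmaK.
have [c cY hc] := IH (decrement m r) h ups.
rewrite -Vp in hc; have := tanisaki_step pV hc; rewrite ri => /ideal_gen_adjoin[u uP].
rewrite -[X in spanned _ _ (_ * X)](subrK (\sum_(ay <- c) ay.1 *: ay.2)) mulrDr.
apply: spannedD.
  rewrite -[X in spanned _ _ X](subrK (u * 'X_p ^+ i.+1)); apply: spannedD.
    exact: spanned_ideal.
  by rewrite mulrC; apply: IHd; lia.
rewrite mulr_sumr; apply: spanned_sum => -[a y] /cY /= yY.
rewrite -scalerAr; apply/spannedZ/spanned_mem/allpairsPdep.
by exists r, y; rewrite mem_enum ri.
Qed.
End Spanning.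

Section Words.
Variable s : nat.
Implicit Types (m : 'I_s -> nat) (w : seq 'I_s).

(** For v = n and m = la these are the words of X. The recursion is that of
    [spanning_list], so that the lengths agree. *)
Fixpoint words v m : seq (seq 'I_s) :=
  if v is v'.+1 then [seq r :: w | r <- enum 'I_s, w <- words v' (decrement m r)]
  else if [forall r, m r == 0%N] then [:: [::]] else [::].

Lemma words_uniq v m : uniq (words v m).
Proof.
elim: v m => [|v IH] m /=; first by case: ifP.
apply: allpairs_uniq_dep => [|r _|[r w] [r' w'] _ _ /= [-> ->]] //; exact: enum_uniq.
Qed.

Lemma words_size v m w : w \in words v m -> size w = v.
Proof.
elim: v m w => [|v IH] m w /=; first by case: ifP => // _; rewrite inE => /eqP->.
by case/allpairsPdep => r [w' [_ /IH <- ->]].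
Qed.

Lemma words_count v m w r : w \in words v m -> (m r <= count_mem r w)%N.
Proof.
elim: v m w => [|v IH] m w /=.
  by case: ifPn => // /forallP/(_ r)/eqP->.
case/allpairsPdep => r' [w' [_ w'W ->]] /=; have := IH _ _ w'W.
by rewrite /decrement leq_subLR eq_sym.
Qed.

Lemma size_spanning_list n (ps : seq 'I_n) m :
  size (spanning_list ps m) = size (words (size ps) m).
Proof.
elim: ps m => [|p ps IH] m /=; first by case: ifP.
by rewrite !size_allpairs_dep; congr sumn; apply: eq_map => r; rewrite IH.
Qed.

Definition word_fun n w : {ffun 'I_n -> nat} := [ffun p : 'I_n => nth 0%N (map val w) p].

Lemma word_fun_inj n w w' : size w = n -> size w' = n ->
  word_fun n w = word_fun n w' -> w = w'.
Proof.
move=> sw sw' eqw; apply: (inj_map val_inj).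
apply: (@eq_from_nth _ 0%N); rewrite !size_map ?sw ?sw' // => i ni.
by have /ffunP/(_ (Ordinal ni)) := eqw; rewrite !ffunE.
Qed.

Lemma word_fun_lt n w p : size w = n -> (word_fun n w p < s)%N.
Proof.
move=> sw; rewrite ffunE; have : nth 0%N (map val w) p \in map val w.
  by rewrite mem_nth // size_map sw.
by case/mapP => r _ ->; apply: (ltn_ord r).
Qed.

Lemma word_fun_count n w (r : 'I_s) : size w = n ->
  count_mem r w = #|[set p | word_fun n w p == r]|.
Proof.
move=> sw; rewrite -sum1_card big_mkcond /=.
have -> : count_mem r w = count_mem (val r) (map val w).
  by rewrite count_map; apply: eq_count => x /=.
rewrite -sum1_count (big_nth 0%N) big_mkcond size_map sw big_mkord.
by apply: eq_bigr => p _; rewrite in_set ffunE.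
Qed.
End Words.

(** * The basis *)

Section Coordinates.
Variables (n : nat) (G : {mpoly rat[n]} -> Prop) (Y : seq {mpoly rat[n]}).
Local Notation N := (size Y).

Lemma spanned_coordinates f : spanned Y G f ->
  exists c : 'rV[rat]_N, f - \sum_j c 0 j *: Y`_j \in ideal_gen G.
Proof.
case=> c cY cG; exists (\row_j \sum_(ay <- c | index ay.2 Y == j) ay.1).
set cf := \row__ _.
have -> : \sum_j cf 0 j *: Y`_j = \sum_(ay <- c) ay.1 *: ay.2; last by [].
transitivity (\sum_(j < N) \sum_(ay <- c)
    if index ay.2 Y == j then ay.1 *: Y`_j else 0).
  by apply: eq_bigr => j _; rewrite mxE scaler_suml big_mkcond.
rewrite exchange_big big_seq [RHS]big_seq; apply: eq_bigr => -[a y] /cY /= yY.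
have iY : (index y Y < N)%N by rewrite index_mem.
rewrite (bigD1 (Ordinal iY)) //= eqxx nth_index // big1 ?addr0 // => j.
by rewrite -val_eqE /= eq_sym => /negbTE->.
Qed.

(** Independence makes the square matrix of the b i in terms of Y invertible. *)
Lemma independent_spans (b : 'I_N -> {mpoly rat[n]}) :
  (forall f, spanned Y G f) ->
  (forall u : 'rV[rat]_N, \sum_i u 0 i *: b i \in ideal_gen G -> u = 0) ->
  forall f, exists a : 'rV[rat]_N, f - \sum_i a 0 i *: b i \in ideal_gen G.
Proof.
move=> Yspan b_free f.
have /fin_all_exists[M0 M0P] : forall i, exists c : 'rV[rat]_N,
    b i - \sum_j c 0 j *: Y`_j \in ideal_gen G.
  by move=> i; apply: spanned_coordinates.
pose M : 'M[rat]_N := \matrix_i M0 i.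
have ME (u : 'rV[rat]_N) :
    \sum_i u 0 i *: b i - \sum_j (u *m M) 0 j *: Y`_j \in ideal_gen G.
  have -> : \sum_j (u *m M) 0 j *: Y`_j = \sum_i u 0 i *: \sum_j M0 i 0 j *: Y`_j.
    under eq_bigr do rewrite mxE scaler_suml.
    rewrite exchange_big; apply: eq_bigr => i _; rewrite scaler_sumr.
    by apply: eq_bigr => j _; rewrite scalerA /M mxE.
  rewrite -sumrB; apply: rpred_sum => i _; rewrite -scalerBr -mulr_algl.
  exact: ideal_genM.
have unitM : M \in unitmx.
  rewrite -row_free_unit; apply: inj_row_free => u uM0; apply: b_free.
  have := ME u; rewrite uM0 [X in _ - X]big1 ?subr0 // => j _.
  by rewrite mxE scale0r.
have [c cP] := spanned_coordinates (Yspan f).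
exists (c *m invmx M); have := ME (c *m invmx M); rewrite mulmxKV // => cM.
by have := rpredB cP cM; rewrite opprB addrA subrK.
Qed.
End Coordinates.

Section Basis.
Variables (n k s : nat) (la : seq nat).
Hypotheses (kn : (k <= n)%N) (la_part : is_part k la) (las : (size la <= s)%N).
Local Notation I := (ideal_gen (@I_gen n la s)).

Let m (r : 'I_s) := nth 0%N la r.
Let W := words n m.

Definition swept (w : seq 'I_s) : 'X_{1..n} :=
  [multinom sweeps (nth 0%N la) s (word_fun n w) p | p < n].

Lemma word_rich w : w \in W -> rich (nth 0%N la) s (word_fun n w).
Proof.
move=> wW r rs; have /= := words_count (Ordinal rs) wW.
by rewrite (word_fun_count _ (words_size wW)).
Qed.

(** The sweeps lead to chains whose sizes are the parts of the transpose. *)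
Lemma swept_Dnls w : w \in W -> Dnls k la s (swept w).
Proof.
move=> wW; pose a := sweeps (nth 0%N la) s (word_fun n w).
apply: (chains_Dnls kn la_part _ _ _ _ (sweeps_chains (part_mono la_part) (word_rich wW))).
- exact: nth0.
- by move=> i; rewrite (conj_partE _ las).
- by move=> p; rewrite mnmE.
- move=> p; have [_ lt] := sweeps_letter (nth 0%N la) s (word_fun n w) p.
  exact/lt/word_fun_lt/(words_size wW).
Qed.

Lemma swept_inj : {in W &, injective swept}.
Proof.
move=> w w' wW w'W eqs; apply: (word_fun_inj (words_size wW) (words_size w'W)).
apply: (sweeps_inj (part_mono la_part) (word_rich wW) (word_rich w'W)).
by apply/ffunP => p; have /mnmP/(_ p) := eqs; rewrite !mnmE.
Qed.

Lemma part_le r : (nth 0%N la r <= n)%N.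
Proof.
apply: leq_trans kn; case/and3P: la_part => _ _ /eqP <-.
case: (ltnP r (size la)) => rs; last by rewrite nth_default.
by rewrite sumnE (big_nth 0%N) big_mkord (bigD1 (Ordinal rs)) //= leq_addr.
Qed.

(** For all the variables and m = la the bound of [tanisaki] is that of the
    theorem, since no part of la exceeds n. *)
Lemma tanisaki_I_gen g : tanisaki [set p in enum 'I_n] m g -> I_gen la s g.
Proof.
case=> [[j ->]|[j + _]|[S [d [_ Sd ->]]]]; first by left; exists j.
  by rewrite !inE mem_enum.
right; exists S, d; split=> //; apply: leq_trans Sd _; rewrite leq_add2l.
have -> : [set p in enum 'I_n] = setT by apply/setP => p; rewrite !inE mem_enum.
rewrite cardsT card_ord big_add1 /=.
under [X in (_ <= X)%N]eq_bigr do rewrite (conj_partE _ las).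
rewrite exchange_big; apply: leq_sum => r _ /=.
by rewrite sum_ltn (minn_idPr (part_le r)).
Qed.

Lemma Dnls_spanning f : exists r : seq 'X_{1..n}, exists c : 'X_{1..n} -> rat,
  (forall b, b \in r -> Dnls k la s b) /\ f - \sum_(b <- r) c b *: 'X_[b] \in I.
Proof.
pose Y := spanning_list (enum 'I_n) m.
have sY : size Y = size W by rewrite size_spanning_list size_enum_ord.
pose b (i : 'I_(size Y)) := swept (nth [::] W i).
have bW (i : 'I_(size Y)) : nth [::] W i \in W by rewrite mem_nth // -sY; apply: ltn_ord.
have b_inj : injective b.
  move=> i j /(swept_inj (bW i) (bW j))/eqP.
  by rewrite nth_uniq ?words_uniq -?sY // => /eqP/val_inj.
have Yspan g : spanned Y (@I_gen n la s) g.
  have [c cY cG] := spanning_list_spans m g (enum_uniq 'I_n).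
  by exists c => //; apply: ideal_gen_sub cG => h; apply: tanisaki_I_gen.
have coef (u : 'rV[rat]_(size Y)) :
    \sum_i u 0 i *: 'X_[b i] = \sum_(x <- map b (enum 'I_(size Y)))
      (\sum_(i | b i == x) u 0 i) *: 'X_[x] :> {mpoly rat[n]}.
  rewrite big_map big_enum; apply: eq_bigr => i _.
  by rewrite (big_pred1 i) // => j; rewrite /= (inj_eq b_inj).
have bD x : x \in map b (enum 'I_(size Y)) -> Dnls k la s x.
  by case/mapP => i _ ->; apply: swept_Dnls.
have [|a aP] := independent_spans (b := fun i => 'X_[b i]) Yspan _ f.
  move=> u; rewrite coef => /Dnls_independent u0; apply/rowP => i; rewrite mxE.
  have := u0 k kn la_part las _ bD (b i) (map_f _ (mem_enum _ i)).
  rewrite map_inj_uniq ?enum_uniq // => /(_ isT).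
  by rewrite (big_pred1 i) // => j; rewrite /= (inj_eq b_inj).
exists (map b (enum 'I_(size Y))), (fun x => \sum_(i | b i == x) a 0 i).
by split=> //; rewrite -coef.
Qed.
End Basis.

Theorem theoremA (n k s : nat) (la : seq nat) :
  (k <= n)%N -> is_part k la -> (size la <= s)%N ->
  is_basis (@Bnls n k la s)
    (fun p : {mpoly rat[n]} =>
       (\pi_(ideal_quotient (@I_gen n la s)) p)%qT : Rnls n la s).
Proof.
move=> kn la_part las; set G := I_gen _ _.
have piE (r : seq {mpoly rat[n]}) (c : {mpoly rat[n]} -> rat) :
    \sum_(p <- r) c p *: ((\pi_(ideal_quotient G) p)%qT : Rnls n la s) =
    (\pi_(ideal_quotient G) (\sum_(p <- r) c p *: p))%qT.
  elim: r => [|p r IH]; first by rewrite !big_nil;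
    apply/esym/(raddf0 (\pi_{ideal_quot ideal G})%qT).
  rewrite !big_cons IH ideal_quotient_piD; congr (_ + _).
  exact: ideal_quotient_piZ.
split=> [r c ur rB|x].
  rewrite piE => /eqP.
  rewrite -(raddf0 (\pi_{ideal_quot ideal G})%qT) ideal_quotient_eqE subr0 => rI p pr.
  have leadE q : q \in r -> q = 'X_[mlead q] by move=> /rB[b _ ->]; rewrite mleadXm.
  have /= := @Dnls_independent n k s la (map (@mlead _ _) r) (fun b => c 'X_[b]) kn la_part
    las.
  rewrite map_inj_in_uniq => [|q q' qr q'r eqq]; last by rewrite (leadE q) // eqq -leadE.
  move=> /(_ ur _ _ (mlead p) (map_f _ pr)); rewrite -leadE //; apply.
    by move=> b /mapP[q /rB[b' b'D ->] ->]; rewrite mleadXm.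
  rewrite big_map big_seq; under eq_bigr => q qr do rewrite -(leadE q qr).
  by rewrite -big_seq.
elim/ideal_quotient_ind: x => f.
have [r [c [rD rI]]] := Dnls_spanning kn la_part las f.
exists (map (fun b => 'X_[b]) r), (fun p => c (mlead p)); split.
  by move=> _ /mapP[b /rD bD ->]; exists b.
rewrite piE big_map; apply/eqP; rewrite ideal_quotient_eqE.
by under eq_bigr do rewrite mleadXm.
Qed.
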